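(* Let $p$ be a prime, $q=p^a$, let $n\ge1$ and let $N\ge 1$ with $p\nmid N$. There are finitely many isomorphism classes of principally ($\Phi_\varepsilon$-positively) polarized Deligne modules of rank $2n$ over $\mathbb F_q$ with real structure and with principal level $N$ structure.
   Context: Let $k=\mathbb F_q$ and fix an embedding $\varepsilon:W(\bar k)\to\mathbb C$. A Deligne module of rank $2n$ over $\mathbb F_q$ is a pair $(T,F)$ with $T$ a free $\mathbb Z$-module of rank $2n$ and $F:T\to T$ an endomorphism such that: $F$ is semisimple and all its eigenvalues in $\mathbb C$ have absolute value $\sqrt q$; exactly half of the eigenvalues of $F$ in $\overline{\mathbb Q}_p$ are $p$-adic units and half are divisible by $q$; the middle coefficient of the characteristic polynomial of $F$ is coprime to $p$; there is an endomorphism $V:T\to T$ with $FV=VF=q$. The algebra $\mathbb Q[F]$ is a product of CM fields, with complex conjugation exchanging $F$ and $V$. The embedding $\varepsilon$ determines a $p$-adic valuation $\mathrm{val}_p$ on the algebraic closure of $\mathbb Q$ in $\mathbb C$; let $\Phi_\varepsilon$ be the CM type on $\mathbb Q[F]$ consisting of all $\phi:\mathbb Q[F]\to\mathbb C$ with $\mathrm{val}_p(\phi(F))>0$. A $\Phi_\varepsilon$-positive polarization is an alternating form $\omega:T\times T\to\mathbb Z$, nondegenerate over $\mathbb Q$, with $\omega(Fx,y)=\omega(x,Vy)$, such that $\omega(x,\iota y)$ is symmetric and positive definite for some (hence any) $\iota\in\mathbb Q[F]$ with $\bar\iota=-\iota$ and $\phi(\iota)$ positive imaginary for all $\phi\in\Phi_\varepsilon$.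 It is principal if $\omega$ induces an isomorphism $T\to\mathrm{Hom}(T,\mathbb Z)$. A real structure (compatible with $\omega$) is a $\mathbb Z$-linear $\tau:T\to T$ with $\tau^2=I$, $\tau F\tau^{-1}=V$ and $\omega(\tau x,\tau y)=-\omega(x,y)$. A principal level $N$ structure, defined when $p\nmid N$ and $F\equiv I \pmod N$, is an isomorphism $\beta:T/NT\to(\mathbb Z/N\mathbb Z)^{2n}$; it is required to be compatible with $\omega$ and $\tau$, i.e. it takes $\omega$ mod $N$ to the reduction of the standard symplectic form $\omega_0$ (matrix $\left(\begin{smallmatrix}0&I\\-I&0\end{smallmatrix}\right)$), and takes $\tau$ mod $N$ to the reduction of the standard involution $\tau_0(x,y)=(-x,y)$. Isomorphisms are group isomorphisms commuting with $F$, $\tau$ and preserving $\omega$ and $\beta$. *)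

(* Defs.v *)
From HB Require Import structures.
From mathcomp Require Import all_boot all_order all_algebra.
From mathcomp Require Import boolp reals constructive_ereal complex.

Set Implicit Arguments.
Unset Strict Implicit.
Unset Printing Implicit Defensive.

Import Order.TTheory GRing.Theory Num.Theory.
Import VectorInternalTheory.
Local Open Scope ring_scope.
Local Open Scope complex_scope.

(* v is an additive valuation on the subfield S of K; it is unspecified
   outside S. *)
Definition valuation_on (R : realType) (K : fieldType) (S : K -> Prop)
    (v : K -> \bar R) : Prop :=
  [/\ v 0 = +oo%E,
      forall x, S x -> x != 0 -> v x \is a fin_num,
      forall x y, S x -> S y -> v (x * y) = (v x + v y)%E
    & forall x y, S x -> S y -> (Order.min (v x) (v y) <= v (x + y)%R)%E].

(* v (p) = 1 forces v to extend the p-adic valuation of Q. *)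
Definition padic_valuation (R : realType) (p : nat) (K : fieldType)
    (v : K -> \bar R) : Prop :=
  valuation_on (fun=> True) v /\ v p%:R = 1%:E.

Definition val_complete (R : realType) (K : fieldType) (v : K -> \bar R) :=
  forall u : nat -> K,
  (forall m : nat, exists i0 : nat, forall i j : nat, (i0 <= i)%N -> (i0 <= j)%N ->
     (m%:R%:E <= v (u i - u j)%R)%E) ->
  exists l : K, forall m : nat, exists i0 : nat, forall i : nat, (i0 <= i)%N ->
     (m%:R%:E <= v (u i - l)%R)%E.

(* A model of the algebraic closure of Q_p. Q_p is the completion of Q: a
   complete field in which Q is dense. All models are isomorphic as valued
   fields. *)
Record padic_closure (R : realType) (p : nat) := PadicClosure {
  Qp : fieldType;
  Qp_val : Qp -> \bar R;
  Qp_valP : padic_valuation p Qp_val;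
  Qp_complete : val_complete Qp_val;
  Qp_dense : forall (x : Qp) (m : nat),
    exists r : rat, (m%:R%:E <= Qp_val (x - ratr r)%R)%E;
  Qpbar :> closedFieldType;
  Qpbar_inj : {rmorphism Qp -> Qpbar};
  Qpbar_alg : integralRange Qpbar_inj;
  Qpbar_val : Qpbar -> \bar R;
  Qpbar_valP : padic_valuation p Qpbar_val;
  Qpbar_val_ext : forall x : Qp, Qpbar_val (Qpbar_inj x) = Qp_val x }.

(* The ring of Witt vectors W(K) of a perfect field K of characteristic p, as
   the complete discrete valuation ring, unique up to unique isomorphism, with
   uniformizer p and residue field K (Serre, Local Fields, II.5). *)
Record witt_ring (p : nat) (K : fieldType) := WittRing {
  witt :> idomainType;
  witt_res : {rmorphism witt -> K};
  witt_res_surj : forall c : K, exists w : witt, witt_res w = c;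
  witt_res_ker : forall w : witt,
    witt_res w = 0 <-> exists u : witt, w = p%:R * u;
  witt_unramified : p%:R != 0 :> witt;
  witt_separated : forall w : witt,
    (forall m : nat, exists u : witt, w = p%:R ^+ m * u) -> w = 0;
  witt_complete : forall w : nat -> witt,
    (forall m : nat, exists u : witt, w m.+1 - w m = p%:R ^+ m * u) ->
    exists l : witt, forall m : nat, exists u : witt, l - w m = p%:R ^+ m * u }.

(* v extends the normalized valuation of W, transported by eps, to the
   algebraic closure in R[i] of the fraction field of eps(W). As W is complete
   there is exactly one such v on that field, which contains the algebraic
   closure of Q in R[i]; only its values there matter. *)
Definition valuation_of_embedding (R : realType) (p : nat) (K : fieldType)
    (W : witt_ring p K) (eps : W -> R[i]) (v : R[i] -> \bar R) : Prop :=
  valuation_on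
    (fun z => exists2 g : {poly W}, map_poly eps g != 0 & root (map_poly eps g) z)
    v /\
  forall (u : W) (m : nat), u \is a GRing.unit ->
    v (eps (u * p%:R ^+ m)) = m%:R%:E.

(* Matrices act on row vectors: v2r (f x) = v2r x *m int_mx f. *)
Definition int_mx (T : vectType int) (f : T -> T) : 'M[int]_(dim T) :=
  lin1_mx (v2r \o f \o r2v).

Definition rat_mx (T : vectType int) (f : T -> T) : 'M[rat]_(dim T) :=
  map_mx intr (int_mx f).

(* Subspaces of Q^d are row spaces of matrices, on which A acts on the right. *)
Definition semisimple_mx (d : nat) (A : 'M[rat]_d) : Prop :=
  forall U : 'M[rat]_d, stablemx U A ->
  exists W : 'M[rat]_d,
    [/\ stablemx W A, (U + W :=: (1%:M : 'M[rat]_d))%MS & (U :&: W)%MS = 0].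

Section PolyAlgebra.
Variables (d : nat) (A : 'M[rat]_d).

(* horner_mx requires the size of the matrix to be a successor. *)
Definition eval_mx (g : {poly rat}) : 'M[rat]_d :=
  \sum_(i < size g) g`_i *: A ^+ i.

Definition QA_pred : {pred 'M[rat]_d} :=
  fun M => `[< exists g : {poly rat}, M = eval_mx g >].

Lemma eval_mx_widen (m : nat) (g : {poly rat}) :
  (size g <= m)%N -> eval_mx g = \sum_(i < m) g`_i *: A ^+ i.
Proof.
move=> le_gm; rewrite /eval_mx (big_ord_widen m (fun i => g`_i *: A ^+ i)) //.
rewrite big_mkcond; apply: eq_bigr => i _ /=.
by case: ltnP => // le_gi; rewrite nth_default // scale0r.
Qed.

Lemma eval_mxD : {morph eval_mx : g h / g + h}.
Proof.
move=> g h; set m := maxn (size g) (size h).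
rewrite (eval_mx_widen (leq_maxl (size g) (size h))).
rewrite (eval_mx_widen (leq_maxr (size g) (size h))).
rewrite (eval_mx_widen (size_polyD g h)) -big_split /=.
by apply: eq_bigr => i _; rewrite coefD scalerDl.
Qed.

Lemma eval_mxZ (c : rat) (g : {poly rat}) : eval_mx (c *: g) = c *: eval_mx g.
Proof.
rewrite (eval_mx_widen (size_scale_leq c g)) scaler_sumr.
by apply: eq_bigr => i _; rewrite coefZ scalerA.
Qed.

Lemma eval_mxMX (g : {poly rat}) : eval_mx (g * 'X) = eval_mx g * A.
Proof.
have le_gX : (size (g * 'X)%R <= (size g).+1)%N.
  by have := size_polyMleq g 'X; rewrite size_polyX addn2.
rewrite (eval_mx_widen le_gX) big_ord_recl coefMX eqxx scale0r add0r mulr_suml.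
by apply: eq_bigr => i _; rewrite coefMX /= exprSr; apply: scalemxAl.
Qed.

Lemma eval_mxC (c : rat) : eval_mx c%:P = c *: 1%:M.
Proof.
rewrite (@eval_mx_widen 1) ?size_polyC ?leq_b1 //.
by rewrite big_ord1 coefC expr0.
Qed.

Lemma eval_mxM : {morph eval_mx : g h / g * h}.
Proof.
move=> g; elim/poly_ind => [|h c IHh].
  by rewrite mulr0 -(scale0r 0) eval_mxZ scale0r mulr0.
rewrite mulrDr mulrA [g * c%:P]mulrC mul_polyC !eval_mxD !eval_mxMX IHh eval_mxZ.
rewrite eval_mxC mulrDr mulrA; congr (_ + _).
by rewrite [RHS](esym (scalemxAr _ _ _)) mulmx1.
Qed.

Lemma QA_subring : subring_closed QA_pred.
Proof.
split=> [|M P /asboolP[g ->] /asboolP[h ->]|M P /asboolP[g ->] /asboolP[h ->]].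
- by apply/asboolP; exists 1%:P; rewrite eval_mxC scale1r.
- apply/asboolP; exists (g + (-1) *: h).
  by rewrite eval_mxD eval_mxZ scaleN1r.
- by apply/asboolP; exists (g * h); rewrite eval_mxM.
Qed.

Record QA := MkQA { QA_mx :> 'M[rat]_d; QA_mxP : QA_mx \in QA_pred }.

HB.instance Definition _ := [isSub for QA_mx].
HB.instance Definition _ := [Choice of QA by <:].
HB.instance Definition _ :=
  GRing.SubChoice_isSubPzRing.Build _ _ QA QA_subring.

Lemma QA_genP : A \in QA_pred.
Proof.
apply/asboolP; exists 'X; rewrite -['X]mul1r eval_mxMX eval_mxC scale1r.
by rewrite mul1r.
Qed.

Definition QA_gen : QA := MkQA QA_genP.

End PolyAlgebra.

Section DeligneModules.
Variables (R : realType) (p : nat) (Qpb : padic_closure R p).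
Variables (n a : nat).
Local Notation q := (p ^ a)%N.

Definition padic_unit (z : Qpb) : bool := Qpbar_val z == 0%E.
Definition divisible_by_q (z : Qpb) : bool :=
  (Qpbar_val (q%:R : Qpb) <= Qpbar_val z)%E.

Record deligne_module := DeligneModule {
  dmT :> vectType int;
  dm_rank : dim dmT = (2 * n)%N;
  dmF : {linear dmT -> dmT};
  dm_semisimple : semisimple_mx (rat_mx dmF);
  dm_weil : forall z : R[i],
    eigenvalue (map_mx intr (int_mx dmF)) z -> `|z| = sqrtC q%:R;
  dm_ordinary : exists rs : seq Qpb,
    [/\ map_poly intr (char_poly (int_mx dmF)) = \prod_(z <- rs) ('X - z%:P),
        count padic_unit rs = n & count divisible_by_q rs = n];
  dm_middle : coprimez (char_poly (int_mx dmF))`_n p;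
  dmV : {linear dmT -> dmT};
  dm_FV : forall x, dmF (dmV x) = x *+ q;
  dm_VF : forall x, dmV (dmF x) = x *+ q }.

(* The Q-bilinear extension of an integral form to 'rV[rat]_(dim T). *)
Definition gram_mx (T : vectType int) (omega : T -> T -> int) :
    'M[rat]_(dim T) :=
  \matrix_(i, j) (omega (r2v (delta_mx 0 i)) (r2v (delta_mx 0 j)))%:~R.

Definition rat_form (T : vectType int) (omega : T -> T -> int)
    (x y : 'rV[rat]_(dim T)) : rat :=
  (x *m gram_mx omega *m y^T) 0 0.

Section Polarization.
Variables (v : R[i] -> \bar R) (D : deligne_module).

Definition QF : pzRingType := QA (rat_mx (dmF D)).

Definition CM_type (phi : {rmorphism QF -> R[i]}) : Prop :=
  (0 < v (phi (QA_gen (rat_mx (dmF D)))))%E.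

(* Complex conjugation is the ring endomorphism of Q[F] mapping F to V. *)
Definition is_QF_conj (c : {rmorphism QF -> QF}) : Prop :=
  QA_mx (c (QA_gen (rat_mx (dmF D)))) = rat_mx (dmV D).

Definition positive_imaginary (z : R[i]) : Prop :=
  complex.Re z = 0 /\ 0 < complex.Im z.

Definition is_polarization (omega : D -> D -> int) : Prop :=
  [/\ forall x, omega x x = 0,
      forall x : 'rV[rat]_(dim D), x != 0 ->
        exists y : 'rV[rat]_(dim D), rat_form omega x y != 0,
      forall x y, omega (dmF D x) y = omega x (dmV D y)
    & exists (c : {rmorphism QF -> QF}) (iota : QF),
      let B (x y : 'rV[rat]_(dim D)) := rat_form omega x (y *m QA_mx iota) in
      [/\ is_QF_conj c,
          c iota = - iota,
          forall phi, CM_type phi -> positive_imaginary (phi iota),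
          forall x y, B x y = B y x
        & forall x : 'rV[rat]_(dim D), x != 0 -> 0 < B x x]].

Definition is_principal (omega : D -> D -> int) : Prop :=
  forall f : {scalar D}, exists! x : D, forall y, omega x y = f y.

Definition is_real_structure (omega : D -> D -> int) (tau : D -> D) : Prop :=
  [/\ forall x, tau (tau x) = x,
      forall x, tau (dmF D (tau x)) = dmV D x
    & forall x y, omega (tau x) (tau y) = - omega x y].

End Polarization.

Section Level.
Variable N : nat.

(* For N > 0 the additive group 'I_N.-1.+1 is Z/NZ, including for N = 1 (where
   'Z_N would be Z/2Z). *)
Definition ZmodN : finZmodType := 'I_N.-1.+1.

Definition reduce (u : 'rV[int]_(n + n)) : 'rV[ZmodN]_(n + n) :=
  map_mx (fun z : int => (inZp 1 : ZmodN) *~ z) u.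

Definition omega0 (u w : 'rV[int]_(n + n)) : int :=
  (u *m block_mx 0 1%:M (- 1%:M) 0 *m w^T) 0 0.

Definition tau0 (u : 'rV[int]_(n + n)) : 'rV[int]_(n + n) :=
  row_mx (- lsubmx u) (rsubmx u).

Definition F_congr_id (D : deligne_module) : Prop :=
  forall x : D, exists y : D, dmF D x - x = y *+ N.

(* The isomorphism T/NT -> (Z/NZ)^2n is given as a surjective homomorphism on T
   with kernel NT. The reductions of omega0 and tau0 are evaluated on integral
   representatives. *)
Definition is_level_structure (D : deligne_module)
    (omega : D -> D -> int) (tau : D -> D)
    (beta : {additive D -> 'rV[ZmodN]_(n + n)}) : Prop :=
  [/\ forall w, exists x, beta x = w,
      forall x, beta x = 0 <-> exists y, x = y *+ N,
      forall x y u w, beta x = reduce u -> beta y = reduce w ->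
        (omega x y = omega0 u w %[mod N])%Z
    & forall x u, beta x = reduce u -> beta (tau x) = reduce (tau0 u)].

End Level.

(* The CM type Phi_eps enters through the valuation v determined by eps. *)
Record real_level_module (v : R[i] -> \bar R) (N : nat) := RealLevelModule {
  rlD :> deligne_module;
  rl_omega : {biscalar rlD};
  rl_polarization : is_polarization v rl_omega;
  rl_principal : is_principal rl_omega;
  rl_tau : {linear rlD -> rlD};
  rl_real : is_real_structure rl_omega rl_tau;
  rl_FN : F_congr_id N rlD;
  rl_beta : {additive rlD -> 'rV[ZmodN N]_(n + n)};
  rl_level : is_level_structure rl_omega rl_tau rl_beta }.

Definition rl_iso (v : R[i] -> \bar R) (N : nat)
    (X Y : real_level_module v N) : Prop :=
  exists f : {additive X -> Y},
    [/\ bijective f,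
        forall x, f (dmF X x) = dmF Y (f x),
        forall x, f (rl_tau X x) = rl_tau Y (f x),
        forall x y, rl_omega Y (f x) (f y) = rl_omega X x y
      & forall x, rl_beta Y (f x) = rl_beta X x].

End DeligneModules.

(* Main.v *)
Require Import Defs.
From HB Require Import structures.
From mathcomp Require Import all_boot all_order all_algebra.
From mathcomp Require Import boolp reals constructive_ereal complex.
From mathcomp Require Import perm spectral sesquilinear ring lra zify.

(* The characteristic polynomials of Frobenius that occur have bounded integer
   coefficients, so there are finitely many of them. Fix one, realised by a
   module whose polarization is positive for [iota0 = h0(F0)], with [h0] an
   integral polynomial. Positivity only depends on the values of [h0] at the
   eigenvalues of [F0], so for every other module with this characteristic
   polynomial [G(x, y) = omega(x, h0(F) y)] is again positive definite, and its
   determinant, the product of the values of [h0] at the eigenvalues, is bounded.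
   By Hermite reduction the integral form [G] takes finitely many values in
   suitable bases. Since [F] multiplies [G] by [q] and [tau] preserves it, there
   are finitely many possible [F] and [tau] for each [G]; [omega] is recovered
   from [G] and [F], and there are finitely many level structures. *)

Set Implicit Arguments.
Unset Strict Implicit.
Unset Printing Implicit Defensive.

Import Order.TTheory GRing.Theory Num.Theory.
Import VectorInternalTheory.
Local Open Scope ring_scope.
Local Open Scope complex_scope.

(** * Positive definite matrices and Hermite reduction *)

Definition posdef (K : realFieldType) (d : nat) (G : 'M[K]_d) : Prop :=
  G^T = G /\ forall x : 'rV_d, x != 0 -> 0 < (x *m G *m x^T) 0 0.

Lemma form_delta (K : pzRingType) (d : nat) (G : 'M[K]_d) (i j : 'I_d) :
  ((delta_mx 0 i : 'rV_d) *m G *m (delta_mx 0 j : 'rV_d)^T) 0 0 = G i j.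
Proof. by rewrite -rowE trmx_delta -colE !mxE. Qed.

Section PosDef.
Variable K : realFieldType.

Lemma posdef_congr (d : nat) (G U : 'M[K]_d) :
  U \in unitmx -> posdef G -> posdef (U *m G *m U^T).
Proof.
move=> Uu [Gs Gp]; split=> [|x x0]; first by rewrite !trmx_mul trmxK Gs mulmxA.
have := Gp (x *m U); rewrite trmx_mul !mulmxA; apply.
by apply: contraNneq x0 => xU; rewrite -(mulmxK Uu x) xU mul0mx.
Qed.

Lemma posdef_diag (d : nat) (G : 'M[K]_d) (i : 'I_d) : posdef G -> 0 < G i i.
Proof.
case=> _ /(_ (delta_mx 0 i)); rewrite form_delta; apply.
by apply/eqP => /matrixP/(_ 0 i)/eqP; rewrite !mxE !eqxx oner_eq0.
Qed.

Lemma posdef_unit (d : nat) (G : 'M[K]_d) : posdef G -> G \in unitmx.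
Proof.
case=> _ Gp; rewrite -row_free_unit -kermx_eq0; apply/eqP/row_matrixP => i.
rewrite row0; apply/eqP/negPn/negP => /Gp.
by rewrite -row_mul mulmx_ker row0 mul0mx mxE ltxx.
Qed.

Definition schur (d : nat) (G : 'M[K]_(1 + d)) : 'M[K]_d :=
  drsubmx G - (G 0 0)^-1 *: (dlsubmx G *m (dlsubmx G)^T).

Lemma ulsubmx11 (d : nat) (G : 'M[K]_(1 + d)) : ulsubmx G = (G 0 0)%:M.
Proof.
by apply/matrixP => i j; rewrite !ord1 !mxE; congr (G _ _); apply: val_inj.
Qed.

(** Each new basis vector splits orthogonally: [w] collects the coefficients along the first basis
    vector, and [schur G] measures the remaining components. *)
Lemma schur_congr (d : nat) (G : 'M[K]_(1 + d)) (c : 'cV_d) (U : 'M_d) :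
    G^T = G -> G 0 0 != 0 ->
  let w := c + (G 0 0)^-1 *: (U *m dlsubmx G) in
  let E := block_mx 1%:M 0 c U in
  E *m G *m E^T = block_mx (G 0 0)%:M (G 0 0 *: w^T) (G 0 0 *: w)
     (U *m schur G *m U^T + G 0 0 *: (w *m w^T)).
Proof.
move=> Gs m0 w E; rewrite /schur -{1}[G]submxK.
have -> : ursubmx G = (dlsubmx G)^T by rewrite trmx_dlsub Gs.
rewrite ulsubmx11; set m := G 0 0; set b := dlsubmx G; set D := drsubmx G.
have wE : m *: w = m *: c + U *m b by rewrite scalerDr scalerA divff // scale1r.
have wD : w = c + m^-1 *: (U *m b) by [].
rewrite {}/E; clearbody w; rewrite mulmx_block tr_block_mx mulmx_block.
rewrite !(mul1mx, mul0mx, mulmx0, mulmx1, addr0, trmx0, trmx1, mul_scalar_mx).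
rewrite mul_mx_scalar -wE; congr block_mx.
  by have := congr1 trmx wE; rewrite linearD !linearZ /= trmx_mul => ->.
rewrite wE; set u := U *m b.
have cu : c *m b^T *m U^T = c *m u^T by rewrite trmx_mul mulmxA.
rewrite mulmxBr mulmxBl -scalemxAr -scalemxAl !mulmxA -/u.
rewrite -(mulmxA u) -trmx_mul -/u !mulmxDl cu wD -/u.
apply/matrixP => i j; rewrite !mxE !big_ord1 !mxE.
by field.
Qed.

Lemma posdef_schur (d : nat) (G : 'M[K]_(1 + d)) :
  posdef G -> posdef (schur G) /\ \det G = G 0 0 * \det (schur G).
Proof.
move=> Gp; have m0 := posdef_diag 0 Gp; have [Gs _] := Gp.
(* With this [c] the column [w] vanishes, so the congruence makes [G] block diagonal. *)
pose c := - ((G 0 0)^-1 *: (1%:M *m dlsubmx G)).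
have := schur_congr c 1%:M Gs (lt0r_neq0 m0).
set E := block_mx _ _ _ _; rewrite /c addNr trmx0 !scaler0 mul0mx scaler0 addr0.
rewrite mul1mx trmx1 mulmx1 => EE.
have dE : \det E = 1 by rewrite det_lblock !det1 mulr1.
split; last first.
  have := congr1 determinant EE.
  by rewrite !det_mulmx det_tr dE mul1r mulr1 det_ublock det_scalar1.
have [Gs' Gp'] : posdef (E *m G *m E^T).
  by apply: posdef_congr; rewrite // unitmxE dE unitr1.
move: Gs' Gp'; rewrite EE tr_block_mx => /eq_block_mx[_ _ _ Ss] Sp.
split=> // x x0; have := Sp (row_mx 0 x).
rewrite mul_row_block tr_row_mx mul_row_col !(mul0mx, mulmx0, add0r, addr0, trmx0).
apply.
by apply: contraNneq x0 => /(congr1 rsubmx); rewrite row_mxKr linear0 => ->.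
Qed.
End PosDef.

Section Hermite.

Local Notation Zq := (map_mx (intr : int -> rat)).

Lemma map_mx_unit (A B : comUnitRingType) (f : {rmorphism A -> B}) (d : nat)
  (U : 'M[A]_d) : U \in unitmx -> map_mx f U \in unitmx.
Proof. by rewrite !unitmxE det_map_mx; apply: rmorph_unit. Qed.

Lemma nearest_int (w : rat) : exists c : int, (c%:~R + w) ^+ 2 <= 4^-1.
Proof.
exists (- Num.floor (w + 2^-1)); have /andP[] := floor_itv (w + 2^-1).
rewrite intrD mulrNz; set c : rat := (Num.floor _)%:~R => h1 h2.
by nra.
Qed.

(** [schur] divides by [G 0 0], so an induction on integral forms would break. A common denominator
    survives instead, and [minimal_basis] works with it. *)
Lemma schur_int (d : nat) (G : 'M[rat]_(1 + d)) (k : nat) :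
    posdef G -> (0 < k)%N -> (forall i j, k%:R * G i j \is a Num.int) ->
  exists2 k' : nat, (0 < k')%N & forall i j, k'%:R * schur G i j \is a Num.int.
Proof.
move=> Gp k0 Gk; have m0 := posdef_diag 0 Gp.
have kn0 : k%:R != 0 :> rat by rewrite pnatr_eq0 -lt0n.
have /natrP[n En] : k%:R * G 0 0 \is a Num.nat.
  by rewrite natrEint Gk mulr_ge0 // ltW.
have n0 : (0 < n)%N by rewrite -(ltr_nat rat) -En mulr_gt0 // ltr0n.
(* As [n = k * G 0 0], the factor [n] absorbs the division by [G 0 0] and leaves products of entries
   of [k * G]. *)
exists (k * n)%N => [|i j]; first by rewrite muln_gt0 k0.
rewrite !mxE big_ord1 !mxE natrM.
set x := G _ _; set y := G _ (lshift _ _); set z := G _ (lshift _ _).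
have -> : k%:R * n%:R * (x - (G 0 0)^-1 * (y * z)) =
    n%:R * (k%:R * x) - (k%:R * y) * (k%:R * z).
  by rewrite -En; field; apply: lt0r_neq0.
by apply: rpredB; apply: rpredM; rewrite ?rpred_nat //; apply: Gk.
Qed.

Lemma congr_int (d : nat) (G : 'M[rat]_d) (k : nat) (U : 'M[int]_d) :
    (forall i j, k%:R * G i j \is a Num.int) ->
  forall i j, k%:R * (Zq U *m G *m (Zq U)^T) i j \is a Num.int.
Proof.
move=> Gk i j.
have -> : k%:R * (Zq U *m G *m (Zq U)^T) i j =
    (Zq U *m (k%:R *: G) *m (Zq U)^T) i j.
  by rewrite -scalemxAr -scalemxAl [RHS]mxE.
have -> : k%:R *: G = Zq (\matrix_(i, j) Num.floor (k%:R * G i j)).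
  by apply/matrixP => i' j'; rewrite !mxE floorK.
by rewrite map_trmx -!map_mxM mxE intr_int.
Qed.

(** Multiplied by [k], the lengths of first basis vectors are natural numbers, so a least one is
    attained. Minimizing over bases rather than over vectors avoids extending a minimal vector to a
    basis. *)
Lemma minimal_basis (d : nat) (G : 'M[rat]_(1 + d)) (k : nat) :
    posdef G -> (0 < k)%N -> (forall i j, k%:R * G i j \is a Num.int) ->
  exists2 U : 'M[int]_(1 + d), U \in unitmx & forall U' : 'M[int]_(1 + d),
    U' \in unitmx -> (Zq U *m G *m (Zq U)^T) 0 0 <= (Zq U' *m G *m (Zq U')^T) 0 0.
Proof.
move=> Gp k0 Gk.
pose f (U : 'M[int]_(1 + d)) := k%:R * (Zq U *m G *m (Zq U)^T) 0 0.
have fn U : U \in unitmx -> exists n : nat, f U = n%:R.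
  move=> Uu; apply/natrP; rewrite natrEint /f; apply/andP; split; last first.
    apply: mulr_ge0 => //; apply/ltW/posdef_diag/posdef_congr => //.
    exact: map_mx_unit.
  exact: congr_int.
pose P n := `[< exists2 U, U \in unitmx & f U = n%:R >].
have exP : exists n, P n.
  have [n En] := fn _ (unitmx1 _ _); exists n; apply/asboolP.
  by exists 1%:M; rewrite ?unitmx1.
case: (ex_minnP exP) => n /asboolP[U Uu En] nmin; exists U => // U' Uu'.
have [n' En'] := fn _ Uu'.
have : f U <= f U' by rewrite En En' ler_nat; apply: nmin; apply/asboolP; exists U'.
by rewrite /f ler_pM2l // ltr0n.
Qed.

Lemma det_int_congr (d : nat) (G : 'M[rat]_d) (U : 'M[int]_d) :
  U \in unitmx -> \det (Zq U *m G *m (Zq U)^T) = \det G.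
Proof.
rewrite unitmxE => Uu; rewrite !det_mulmx det_tr mulrAC det_map_mx -intrM.
by case/orP: Uu => /eqP ->; rewrite ?mulrNN mulr1 mul1r.
Qed.

(* Choose a basis whose first vector has minimal length [m] among all first
   vectors of bases, reduce the Schur complement [S] by induction and translate
   the other vectors by multiples of the first. Each of these then has length
   between [m] and [S i i + m / 4], hence at most [4 / 3 * S i i]. *)
Theorem hermite_reduction (d : nat) : exists2 C : rat, 0 < C &
  forall (G : 'M[rat]_d) (k : nat), posdef G -> (0 < k)%N ->
    (forall i j, k%:R * G i j \is a Num.int) ->
  exists2 U : 'M[int]_d, U \in unitmx &
    \prod_i (Zq U *m G *m (Zq U)^T) i i <= C * \det G.
Proof.
elim: d => [|d [C C0 IH]].
  exists 1 => // G k _ _ _; exists 1%:M; first exact: unitmx1.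
  by rewrite big_ord0 det_mx00 mulr1.
exists ((4 / 3) ^+ d * C) => [|G k Gp k0 Gk]; first by rewrite mulr_gt0 // exprn_gt0.
have [U0 U0u U0min] := @minimal_basis d G k Gp k0 Gk.
pose G1 : 'M_(1 + d) := Zq U0 *m G *m (Zq U0)^T.
have G1p : posdef G1 by apply: posdef_congr => //; apply: map_mx_unit.
have G1k : forall i j, k%:R * G1 i j \is a Num.int by apply: congr_int.
have [Sp G1det] := posdef_schur G1p.
have [k' k'0 Sk] := schur_int G1p k0 G1k.
have [U1 U1u U1C] := IH _ _ Sp k'0 Sk.
set S := Zq U1 *m _ *m _ in U1C.
pose m := G1 0 0; have m0 : 0 < m := posdef_diag 0 G1p.
pose u := m^-1 *: (Zq U1 *m dlsubmx G1).
(* Rounding: adding [c i] brings the coefficient of the [i]-th vector along the first one into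
   [[-1/2, 1/2]]. *)
have [c Hc] := choice (fun i => nearest_int (u i 0)).
pose cv : 'cV[int]_d := \col_i c i.
pose E : 'M[int]_(1 + d) := block_mx 1%:M 0 cv U1.
have Eu : E \in unitmx by rewrite unitmxE det_lblock det1 mul1r -unitmxE.
have ZE : Zq E = block_mx 1%:M 0 (Zq cv) (Zq U1).
  by rewrite map_block_mx map_mx1 map_mx0.
have [G1s _] := G1p.
have := schur_congr (Zq cv) (Zq U1) G1s (lt0r_neq0 m0).
rewrite -ZE -/S -/m -/u; set w := Zq cv + u => GE.
have Eu0 : E *m U0 \in unitmx by rewrite unitmx_mul Eu.
exists (E *m U0) => //.
have -> : Zq (E *m U0) *m G *m (Zq (E *m U0))^T = Zq E *m G1 *m (Zq E)^T.
  by rewrite map_mxM trmx_mul !mulmxA.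
have diagE i : (Zq E *m G1 *m (Zq E)^T) (rshift 1 i) (rshift 1 i) =
    S i i + m * w i 0 ^+ 2.
  by rewrite GE block_mxEdr !mxE big_ord1 !mxE expr2.
have small i : w i 0 ^+ 2 <= 4^-1 by rewrite mxE [Zq cv i 0]mxE [cv i 0]mxE; apply: Hc.
have mmin i : m <= S i i + m * w i 0 ^+ 2.
  rewrite -diagE.
  (* Exchanging this vector with the first one gives another basis, to which the minimality of [m]
     applies. *)
  have Pu : tperm_mx 0 (rshift 1 i) *m E *m U0 \in unitmx.
    by rewrite !unitmx_mul unitmx_perm Eu.
  have := U0min _ Pu; rewrite -/G1 -/m => /le_trans; apply.
  have -> : Zq (tperm_mx 0 (rshift 1 i) *m E *m U0) =
      tperm_mx 0 (rshift 1 i) *m (Zq E *m Zq U0).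
    by rewrite !map_mxM map_tperm_mx mulmxA.
  set T := tperm_mx _ _; have permE (M : 'M[rat]_(1 + d)) :
      (T *m M *m T^T) 0 0 = M (rshift 1 i) (rshift 1 i).
    by rewrite tr_tperm_mx -xcolE -xrowE !mxE !tpermL.
  by rewrite -permE !trmx_mul !mulmxA lexx.
have bound i : S i i + m * w i 0 ^+ 2 <= 4 / 3 * S i i.
  by have := small i; have := mmin i; nra.
have Spos i : 0 < S i i.
  by apply/posdef_diag/posdef_congr => //; apply: map_mx_unit.
have G00 : (Zq E *m G1 *m (Zq E)^T) (lshift d 0) (lshift d 0) = m.
  by rewrite GE block_mxEul mxE eqxx mulr1n.
rewrite (@big_split_ord _ _ _ 1 d) big_ord1 /= [X in X * _]G00.
rewrite -(det_int_congr G U0u) -/G1 G1det -/m.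
rewrite mulrCA ler_pM2l //.
have -> : (4 / 3) ^+ d * C * \det (schur G1) =
    (\prod_(i < d) (4 / 3)) * (C * \det (schur G1)).
  by rewrite prodr_const card_ord mulrA.
apply: (le_trans (y := \prod_(i < d) (4 / 3 * S i i))).
  apply: ler_prod => i _; rewrite diagE bound andbT.
  exact: le_trans (ltW m0) (mmin i).
by rewrite big_split /= ler_pM2l // prodr_gt0.
Qed.
End Hermite.

(** * Bounds for reduced forms, short vectors and similitudes *)

Section Bounds.
Local Notation Zq := (map_mx (intr : int -> rat)).

Lemma posdef_ge0 (K : realFieldType) (d : nat) (G : 'M[K]_d) (x : 'rV_d) :
  posdef G -> 0 <= (x *m G *m x^T) 0 0.
Proof.
case=> _ Gp; have [->|/Gp/ltW //] := eqVneq x 0.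
by rewrite !mul0mx mxE.
Qed.

Lemma form_sym (K : realFieldType) (d : nat) (G : 'M[K]_d) (x y : 'rV_d) :
  G^T = G -> (x *m G *m y^T) 0 0 = (y *m G *m x^T) 0 0.
Proof.
move=> Gs; have -> : (x *m G *m y^T) 0 0 = (x *m G *m y^T)^T 0 0 by rewrite [RHS]mxE.
by rewrite !trmx_mul trmxK Gs mulmxA.
Qed.

Lemma form_lincomb (K : realFieldType) (d : nat) (G : 'M[K]_d) (x y : 'rV_d) (a b : K) :
    G^T = G ->
  ((a *: x + b *: y) *m G *m (a *: x + b *: y)^T) 0 0 =
  a ^+ 2 * (x *m G *m x^T) 0 0 + 2 * a * b * (x *m G *m y^T) 0 0
  + b ^+ 2 * (y *m G *m y^T) 0 0.
Proof.
move=> Gs; have E : (y *m G *m x^T) 0 0 = (x *m G *m y^T) 0 0 by apply: form_sym.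
rewrite linearD !linearZ /= !mulmxDl !mulmxDr -!scalemxAl -!scalemxAr.
move: E; set p := y *m G *m x^T; set r := x *m G *m y^T.
set s := x *m G *m x^T; set t := y *m G *m y^T.
by rewrite !mxE => ->; ring.
Qed.

Lemma cauchy_schwarz (K : realFieldType) (d : nat) (G : 'M[K]_d) (x y : 'rV_d) :
    posdef G ->
  (x *m G *m y^T) 0 0 ^+ 2 <= (x *m G *m x^T) 0 0 * (y *m G *m y^T) 0 0.
Proof.
move=> Gp; have [Gs Gpos] := Gp.
have [->|y0] := eqVneq y 0; first by rewrite trmx0 !mulmx0 mxE expr0n mulr0.
have yp := Gpos _ y0.
(* The vector [(y, y) x - (x, y) y] is orthogonal to [y]; its length factors as
   [c * (a * c - b ^+ 2)]. *)
have := posdef_ge0 ((y *m G *m y^T) 0 0 *: x + (- (x *m G *m y^T) 0 0) *: y) Gp.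
rewrite form_lincomb //; set a := (x *m G *m x^T) 0 0.
set b := (x *m G *m y^T) 0 0; set c := (y *m G *m y^T) 0 0 in yp *.
have -> : c ^+ 2 * a + 2 * c * - b * b + (- b) ^+ 2 * c = c * (a * c - b ^+ 2) by ring.
by rewrite pmulr_rge0 // subr_ge0.
Qed.

Lemma intmx_norm_le (m n : nat) (A : 'M[int]_(m, n)) (i : 'I_m) (j : 'I_n) :
  `|A i j| <= \sum_i \sum_j `|A i j|.
Proof.
rewrite (bigD1 i) //= (bigD1 j) //= -addrA lerDl addr_ge0 //.
  by rewrite sumr_ge0.
by rewrite sumr_ge0 // => *; rewrite sumr_ge0.
Qed.

(** By integrality the diagonal entries are at least 1, so in a Hermite reduced basis each is at
    most their product. Positivity at the sum and the difference of two basis vectors then bounds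
    the other entries. *)
Lemma reduced_bounded (d : nat) (Delta : rat) : exists M : int,
  forall G : 'M[int]_d, posdef (Zq G) -> \det (Zq G) <= Delta ->
  exists2 U : 'M[int]_d, U \in unitmx & forall i j, `|(U *m G *m U^T) i j| <= M.
Proof.
have [C C0 hC] := hermite_reduction d.
exists (Num.ceil (C * Delta)) => G Gp Gd.
have [i j|U Uu Uprod] := hC (Zq G) 1%N Gp isT; first by rewrite mul1r mxE intr_int.
exists U => // i0 j0; set G' := U *m G *m U^T.
have ZG' : Zq U *m Zq G *m (Zq U)^T = Zq G' by rewrite map_trmx -!map_mxM.
have G'p : posdef (Zq G').
  by rewrite -ZG'; apply: posdef_congr => //; apply: map_mx_unit.
have diag1 i : 1 <= Zq G' i i.
  by have := posdef_diag i G'p; rewrite mxE ltr0z ler1z.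
have diagC i : Zq G' i i <= C * Delta.
  apply: (le_trans _ (le_trans Uprod _)); last by rewrite ler_pM2l.
  rewrite ZG' (bigD1 i) //= ler_peMr ?(le_trans ler01) //.
  by elim/big_ind: _ => // x y; apply: mulr_ege1.
have G'C i : G' i i <= Num.ceil (C * Delta).
  have := diagC i; rewrite mxE => /le_trans/(_ (ceil_ge _)).
  by rewrite ler_int.
have G's : G' j0 i0 = G' i0 j0.
  have [/matrixP/(_ i0 j0)] := G'p; rewrite !mxE => /eqP.
  by rewrite eqr_int => /eqP.
have := posdef_ge0 (1 *: delta_mx 0 i0 + 1 *: delta_mx 0 j0) G'p.
have := posdef_ge0 (1 *: delta_mx 0 i0 + (- 1) *: delta_mx 0 j0) G'p.
have [Gs _] := G'p; rewrite !form_lincomb // !form_delta.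
have := G'C i0; have := G'C j0; rewrite !mxE -!(ler_int rat) intr_norm ler_norml.
by move=> h1 h2 h3 h4; apply/andP; split; lra.
Qed.

(** The coordinate [x 0 j] is the product of [x] with the dual basis vector [y j], so Cauchy-Schwarz
    bounds it. *)
Lemma short_vectors (d : nat) (G : 'M[int]_d) (K : int) : posdef (Zq G) ->
  exists M : int, forall x : 'rV[int]_d, (x *m G *m x^T) 0 0 <= K ->
  forall j, `|x 0 j| <= M.
Proof.
move=> Gp; have Gu := posdef_unit Gp; have [Gs _] := Gp.
pose y j : 'rV_d := delta_mx 0 j *m invmx (Zq G).
pose D j := (y j *m Zq G *m (y j)^T) 0 0.
have D0 j : 0 <= D j by apply: posdef_ge0.
exists (Num.ceil (\sum_j (K%:~R * D j))) => x xK j.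
have xy : (Zq x *m Zq G *m (y j)^T) 0 0 = (x 0 j)%:~R.
  by rewrite form_sym // mulmxKV // -rowE !mxE.
have xx : (Zq x *m Zq G *m (Zq x)^T) 0 0 = ((x *m G *m x^T) 0 0)%:~R.
  by rewrite map_trmx -!map_mxM mxE.
have K0 : 0 <= K%:~R :> rat.
  by apply: le_trans (posdef_ge0 (Zq x) Gp) _; rewrite xx ler_int.
have := cauchy_schwarz (Zq x) (y j) Gp; rewrite xy xx -/(D j) => cs.
have {}cs : (x 0 j)%:~R ^+ 2 <= K%:~R * D j.
  by apply: le_trans cs _; rewrite ler_wpM2r // ler_int.
have sq : `|x 0 j| <= x 0 j ^+ 2.
  by rewrite -normr_id; case: (x 0 j) => [] [|n] //; nia.
rewrite -(ler_int rat) (le_trans _ (ceil_ge _)) //.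
apply: (le_trans (y := (x 0 j ^+ 2)%:~R)); first by rewrite ler_int.
rewrite rmorphXn /=; apply: le_trans cs _.
by rewrite (bigD1 j) //= lerDl sumr_ge0 // => i _; apply: mulr_ge0.
Qed.

(** The rows of [A] are vectors of length [q * G i i], hence short. *)
Lemma similitudes_bounded (d : nat) (G : 'M[int]_d) (q : int) : posdef (Zq G) ->
  exists M : int, forall A : 'M[int]_d, A *m G *m A^T = q *: G ->
  forall i j, `|A i j| <= M.
Proof.
move=> Gp; have [M HM] := short_vectors (\sum_i \sum_j `|(q *: G) i j|) Gp.
exists M => A AG i j; have -> : A i j = row i A 0 j by rewrite mxE.
apply: HM; have -> : (row i A *m G *m (row i A)^T) 0 0 = (q *: G) i i.
  by rewrite -AG -(form_delta _ i i) rowE trmx_mul !mulmxA.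
by apply: le_trans (ler_norm _) _; apply: intmx_norm_le.
Qed.

End Bounds.

(** * Spectral decomposition of similitudes *)

(** Gram-Schmidt without normalization, so no square roots are taken: the first basis vector is
    split off and the Schur complement is diagonalized by induction. *)
Lemma posdef_diagonalize (K : realFieldType) (d : nat) (G : 'M[K]_d) :
  posdef G -> exists (S : 'M[K]_d) (D : 'rV[K]_d),
    [/\ S \in unitmx, forall i, 0 < D 0 i & S *m G *m S^T = diag_mx D].
Proof.
elim: d => [|d IH] in G * => Gp.
  by exists 1%:M, 0; split; [exact: unitmx1 | case | apply/matrixP => [[]]].
have [Sp _] := @posdef_schur K d G Gp.
have m0 : 0 < G 0 0 := posdef_diag 0 Gp.
have [Gs _] := Gp; have [S [D [Su D0 SD]]] := IH _ Sp.
pose c := - ((G 0 0)^-1 *: (S *m @dlsubmx K 1 d 1 d G)).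
have w0 : c + (G 0 0)^-1 *: (S *m @dlsubmx K 1 d 1 d G) = 0 by rewrite addNr.
have := @schur_congr K d G c S Gs (lt0r_neq0 m0).
cbv zeta; rewrite w0 trmx0 !scaler0 mul0mx scaler0 addr0 SD => E.
exists (block_mx 1%:M 0 c S : 'M_(1 + d)), (row_mx (G 0 0)%:M D : 'rV_(1 + d)); split.
- by rewrite unitmxE (@det_lblock K 1 d) det1 mul1r -unitmxE.
- by move=> i; rewrite mxE; case: splitP => j _ //; rewrite ord1 mxE eqxx mulr1n.
- rewrite E; apply: etrans (esym (diag_mx_row (G 0 0)%:M D)); congr block_mx.
  by apply/matrixP => i j; rewrite !mxE !ord1 !eqxx.
Qed.

Section Spectral.
Local Open Scope sesquilinear_scope.
Variable C : numClosedFieldType.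
Local Notation Zq := (map_mx (intr : int -> rat)).
Local Notation Zc := (map_mx (intr : int -> C)).
Local Notation Qc := (map_mx (ratr : rat -> C)).

Lemma trmxC_mul (m n r : nat) (A : 'M[C]_(m, n)) (B : 'M[C]_(n, r)) :
  (A *m B)^t* = B^t* *m A^t*.
Proof. by rewrite trmx_mul map_mxM. Qed.

Lemma trmxC_rat (m n : nat) (A : 'M[rat]_(m, n)) : (Qc A)^t* = (Qc A)^T.
Proof.
by apply/matrixP => i j; rewrite !mxE; apply: fmorph_rat.
Qed.

Lemma trmxC_diag (n : nat) (D : 'rV[C]_n) :
  (diag_mx D)^t* = diag_mx (map_mx Num.conj D).
Proof. by rewrite tr_diag_mx map_diag_mx. Qed.

(** Diagonalize over the rationals and take the square roots of the diagonal in [C]; they are real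
    because the diagonal is positive. *)
Lemma posdef_factor (d : nat) (G : 'M[rat]_d) : posdef G ->
  exists2 L : 'M[C]_d, L \in unitmx & Qc G = L *m L^t*.
Proof.
move=> /posdef_diagonalize[S [D [Su D0 SD]]].
have Scu : Qc S \in unitmx by rewrite map_unitmx.
pose W := diag_mx (map_mx (fun x : rat => sqrtC (ratr x : C)) D).
have Wreal : W^t* = W.
  rewrite trmxC_diag; congr diag_mx; apply/matrixP => i j; rewrite !mxE !ord1.
  by apply: geC0_conj; rewrite sqrtC_ge0 ler0q ltW.
have WW : W *m W = Qc (diag_mx D).
  rewrite map_diag_mx mulmx_diag; congr diag_mx; apply/matrixP => i j.
  by rewrite !mxE ord1 -expr2 sqrtCK.
have Wu : W \in unitmx.
  rewrite unitmxE det_diag unitfE; apply/prodf_neq0 => i _.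
  by rewrite mxE sqrtC_eq0 fmorph_eq0 lt0r_neq0.
exists (invmx (Qc S) *m W); first by rewrite unitmx_mul unitmx_inv Scu.
have E : Qc S *m Qc G *m (Qc S)^t* = W *m W.
  by rewrite trmxC_rat map_trmx -!map_mxM SD.
rewrite trmxC_mul Wreal mulmxA -(mulmxA _ W W) -E !mulmxA mulVmx // mul1mx.
by rewrite -mulmxA -trmxC_mul mulVmx // trmx1 map_mx1 mulmx1.
Qed.

(** Writing [G] as [L L^*] turns [A] into [F = L^-1 A L] with [F F^* = q]. Thus [F] is normal, and
    its unitary eigenbasis, transported back by [L], is orthonormal for [G]. *)
Lemma similitude_diagonalize (d : nat) (A G : 'M[rat]_d) (q : nat) :
    posdef G -> (0 < q)%N -> A *m G *m A^T = q%:R *: G ->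
  exists (Q : 'M[C]_d) (z : 'rV[C]_d),
    [/\ Q \in unitmx, Q *m Qc G *m Q^t* = 1%:M & Q *m Qc A = diag_mx z *m Q].
Proof.
move=> Gp q0 AG; have [L Lu GL] := posdef_factor Gp.
pose F := invmx L *m Qc A *m L.
have qn0 : q%:R != 0 :> C by rewrite pnatr_eq0 -lt0n.
have FF : F *m F^t* = q%:R *: 1%:M.
  rewrite /F !trmxC_mul !mulmxA -(mulmxA _ L) -GL -(mulmxA _ _ (Qc G)).
  rewrite trmxC_rat map_trmx -map_mxM -(mulmxA _ _ (Qc A^T)) -map_mxM AG.
  rewrite map_mxZ rmorph_nat -scalemxAr -scalemxAl GL mulmxA mulVmx // mul1mx.
  by rewrite -trmxC_mul mulVmx // trmx1 map_mx1.
have Fn : F \is normalmx.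
  apply/normalmxP; rewrite FF.
  (* A one-sided inverse of a square matrix is two-sided, which turns [F F^* = q] into
     [F^* F = q]. *)
  have : F *m (q%:R^-1 *: F^t*) = 1%:M by rewrite -scalemxAr FF scalerA mulVf ?scale1r.
  move=> /mulmx1C; rewrite -scalemxAl => /(congr1 (fun M => q%:R *: M)).
  by rewrite scalerA mulfV // scale1r.
set P := spectralmx F; have Pu : P \is unitarymx := spectral_unitarymx F.
have Punit := unitarymx_unit Pu.
exists (P *m invmx L), (spectral_diag F); split.
- by rewrite unitmx_mul Punit unitmx_inv.
- rewrite GL trmxC_mul !mulmxA mulmxKV // -(mulmxA P) -trmxC_mul mulVmx //.
  by rewrite trmx1 map_mx1 mulmx1; apply/unitarymxP.
- have /orthomx_spectralP FE := Fn.
  have : P *m F = diag_mx (spectral_diag F) *m P.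
    by rewrite [in LHS]FE !mulmxA mulmxV // mul1mx.
  move=> /(congr1 (mulmx^~ (invmx L))); rewrite /F !mulmxA => <-.
  by rewrite -(mulmxA _ L) mulmxV // mulmx1.
Qed.

Lemma map_ratr_int (m n : nat) (A : 'M[int]_(m, n)) : Qc (Zq A) = Zc A.
Proof. by apply/matrixP => i j; rewrite !mxE ratr_int. Qed.

Lemma trmxC_int (m n : nat) (A : 'M[int]_(m, n)) : (Zc A)^t* = (Zc A)^T.
Proof. by rewrite -map_ratr_int trmxC_rat. Qed.

Lemma horner_mx_intertwine (d : nat) (A : 'M[int]_d.+1) (Q : 'M[C]_d.+1)
    (z : 'rV[C]_d.+1) (g : {poly int}) :
    Q \in unitmx -> Q *m Zc A = diag_mx z *m Q ->
  Q *m Zc (horner_mx A g) =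
    diag_mx (map_mx (horner (map_poly intr g)) z) *m Q.
Proof.
move=> Qu QA; rewrite map_horner_mx -horner_mx_diag.
have -> : diag_mx z = Q *m Zc A *m invmx Q by rewrite QA mulmxK.
by rewrite horner_mx_uconj // mulmxKV.
Qed.

(** [V] is the adjoint of [A] for [Om], and [A] commutes with [horner_mx A g], so moving [A] across
    the form produces the factor [A *m V]. *)
Lemma form_horner_similitude (d : nat) (A V Om : 'M[int]_d.+1) (q : nat)
    (g : {poly int}) :
    A *m V = q%:R *: 1%:M -> A *m Om = Om *m V^T ->
  let G := Om *m (horner_mx A g)^T in A *m G *m A^T = q%:R *: G.
Proof.
move=> AV AOm G; rewrite /G mulmxA AOm -!mulmxA -!trmx_mul.
have -> : A *m horner_mx A g *m V = q%:R *: horner_mx A g.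
  have /comm_mx_horner cA : comm_mx A A by [].
  by rewrite (cA g) -mulmxA AV -scalemxAr mulmx1.
by rewrite linearZ /= -scalemxAr.
Qed.

(* In an eigenbasis of [A] that is orthonormal for [Om *m g1(A)^T], the form
   [Om *m g0(A)^T] is diagonal with entries [g0(z) / g1(z)]. *)
Lemma posdef_change_polarization (d : nat) (A V Om : 'M[int]_d.+1) (q : nat)
    (g0 g1 : {poly int}) :
    (0 < q)%N -> A *m V = q%:R *: 1%:M -> A *m Om = Om *m V^T ->
    posdef (Zq (Om *m (horner_mx A g1)^T)) ->
    (forall z : C, eigenvalue (Zc A) z -> exists2 t : C, 0 < t &
       (map_poly intr g0).[z] = t * (map_poly intr g1).[z]) ->
  posdef (Zq (Om *m (horner_mx A g0)^T)) /\
  exists2 z : 'rV[C]_d.+1, forall i, eigenvalue (Zc A) (z 0 i) &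
    (\det (horner_mx A g0))%:~R = \prod_i (map_poly intr g0).[z 0 i].
Proof.
move=> q0 AV AOm G1p Hg.
have AG := form_horner_similitude g1 AV AOm.
have ZAG : Zq A *m Zq (Om *m (horner_mx A g1)^T) *m (Zq A)^T =
    q%:R *: Zq (Om *m (horner_mx A g1)^T).
  by rewrite map_trmx -!map_mxM AG map_mxZ rmorph_nat.
have [Q [z [Qu QG QA]]] := similitude_diagonalize G1p q0 ZAG.
rewrite !map_ratr_int in QG QA.
have zeig i : eigenvalue (Zc A) (z 0 i).
  apply/eigenvalueP; exists (row i Q).
    by rewrite -row_mul QA row_mul row_diag_mx -scalemxAl -rowE.
  apply/negP => /eqP; rewrite rowE => /(congr1 (mulmx^~ (invmx Q))).
  rewrite mulmxK // mul0mx => /matrixP/(_ 0 i)/eqP.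
  by rewrite !mxE !eqxx oner_eq0.
have QH g := horner_mx_intertwine g Qu QA.
have /choice[t Ht] : forall i, exists t, 0 < t /\
    (map_poly intr g0).[z 0 i] = t * (map_poly intr g1).[z 0 i].
  by move=> i; have [u u0 Eu] := Hg _ (zeig i); exists u.
pose T : 'M[C]_d.+1 := diag_mx (\row_i t i).
have TC : T^t* = T.
  rewrite trmxC_diag; congr diag_mx; apply/matrixP => i j; rewrite !mxE.
  by apply: geC0_conj; apply/ltW; have [] := Ht j.
pose D g : 'M[C]_d.+1 := diag_mx (map_mx (horner (map_poly intr g)) z).
have D0T : D g0 = T *m D g1.
  rewrite mulmx_diag; congr diag_mx; apply/matrixP => i j; rewrite !mxE ord1.
  by have [] := Ht j.
have QGQ g : Q *m Zc (Om *m (horner_mx A g)^T) *m Q^t* =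
    Q *m Zc Om *m Q^t* *m (D g)^t*.
  rewrite map_mxM (_ : Zc _^T = (Zc (horner_mx A g))^t*); last first.
    by rewrite trmxC_int map_trmx.
  rewrite mulmxA -(mulmxA (Q *m _)) -trmxC_mul.
  by rewrite QH trmxC_mul mulmxA.
set G0 := Om *m (horner_mx A g0)^T.
(* In the eigenbasis the forms of [g0] and [g1] differ by the diagonal matrix [T], and the form of
   [g1] is the identity there. *)
have QG0 : Q *m Zc G0 *m Q^t* = T.
  by rewrite QGQ D0T trmxC_mul TC mulmxA -QGQ QG mul1mx.
have QCu : Q^t* \in unitmx by rewrite map_unitmx unitmx_tr.
have G0E : Zc G0 = invmx Q *m T *m invmx (Q^t*).
  by rewrite -QG0 !mulmxA mulVmx // mul1mx mulmxK.
(* [T] is real diagonal, so [Zc G0] is Hermitian; having integral entries, [G0] is symmetric. *)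
have G0s : G0^T = G0.
  suff /matrixP E : Zc G0^T = Zc G0.
    by apply/matrixP => i j; have /eqP := E i j; rewrite !mxE eqr_int => /eqP.
  rewrite -map_trmx -trmxC_int.
  apply: (can_inj (mulKmx Qu)); apply: (can_inj (mulmxK QCu)).
  by rewrite QG0 -TC -QG0 !trmxC_mul trmxCK mulmxA.
split; first split.
- by rewrite map_trmx G0s.
- move=> x x0; rewrite -(ltr_rat C) rmorph0.
  have -> : ratr ((x *m Zq G0 *m x^T) 0 0) = (Qc x *m Zc G0 *m (Qc x)^t*) 0 0.
    by rewrite trmxC_rat -map_ratr_int map_trmx -!map_mxM [RHS]mxE.
  (* In the coordinates [y] the form becomes the sum of the [t j * |y 0 j| ^+ 2]. *)
  pose y := Qc x *m invmx Q.
  have y0 : y != 0.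
    apply: contraNneq x0 => /(congr1 (mulmx^~ Q)); rewrite mulmxKV // mul0mx => /eqP.
    by rewrite map_mx_eq0.
  have -> : Qc x = y *m Q by rewrite mulmxKV.
  rewrite trmxC_mul !mulmxA -(mulmxA y) -(mulmxA y) QG0.
  rewrite mul_mx_diag mxE (eq_bigr (fun j => t j * `|y 0 j| ^+ 2)) => [|j _]; last first.
    by rewrite !mxE normCK; ring.
  have [j yj] : exists j, y 0 j != 0.
    by have /rV0Pn[j yj] := y0; exists j.
  rewrite (bigD1 j) //= ltr_wpDr //.
    by apply: sumr_ge0 => i _; rewrite mulr_ge0 ?exprn_ge0 // ltW //; have [] := Ht i.
  by rewrite mulr_gt0 ?exprn_gt0 ?normr_gt0 //; have [] := Ht j.
exists z => //; have := congr1 determinant (QH g0).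
rewrite !det_mulmx det_diag det_map_mx mulrC => /mulIf ->.
  by apply: eq_bigr => i _; rewrite mxE.
by rewrite -unitfE -unitmxE.
Qed.

End Spectral.

(** * Bounds from the absolute values of the eigenvalues *)

Section EigenvalueBounds.
Variable C : numClosedFieldType.
Local Notation Zq := (map_mx (intr : int -> rat)).
Local Notation Zc := (map_mx (intr : int -> C)).

Lemma horner_norm_le (g : {poly int}) (z : C) (q : nat) : `|z| <= q%:R ->
  `|(map_poly intr g).[z]| <= (\sum_(i < size g) `|g`_i| * q%:R ^+ i)%:~R.
Proof.
move=> zq; rewrite horner_coef size_map_inj_poly ?rmorph0 //; last exact: intr_inj.
rewrite rmorph_sum /=; apply: le_trans (ler_norm_sum _ _ _) _.
apply: ler_sum => i _; rewrite coef_map /= normrM normrX -intr_norm rmorphM rmorphXn /=.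
by apply: ler_pM => //; rewrite ?normr_ge0 ?exprn_ge0 // lerXn2r ?nnegrE // rmorph_nat.
Qed.

(** A factor ['X - z%:P] adds to a shifted coefficient at most [b] times another one, so it
    multiplies a uniform bound by at most [1 + b]. *)
Lemma coef_prod_XsubC_norm_le (s : seq C) (b : C) (k : nat) :
    0 <= b -> all (fun z => `|z| <= b) s ->
  `|(\prod_(z <- s) ('X - z%:P))`_k| <= (1 + b) ^+ size s.
Proof.
move=> b0; elim: s k => [|z s IH] k /=.
  by rewrite big_nil coef1; case: (k == 0%N); rewrite ?normr1 ?normr0.
case/andP=> zb sb; rewrite big_cons mulrBl coefB coefXM mul_polyC coefZ exprS.
rewrite mulrDl mul1r; apply: le_trans (ler_normB _ _) _; apply: lerD.
  by case: k => [|k] /=; rewrite ?normr0 ?IH // exprn_ge0 // addr_ge0.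
by rewrite normrM ler_pM // IH.
Qed.

Lemma char_poly_coef_bounded (d q : nat) (A : 'M[int]_d) (k : nat) :
    (forall z : C, eigenvalue (Zc A) z -> `|z| <= q%:R) ->
  `|(char_poly A)`_k| <= (1 + q%:R) ^+ d.
Proof.
move=> Aq.
have [s sE] : exists s : seq C, char_poly (Zc A) = \prod_(z <- s) ('X - z%:P).
  have [s sE] := closed_field_poly_normal (char_poly (Zc A)); exists s.
  by rewrite [LHS]sE (monicP (char_poly_monic _)) scale1r.
have sq : all (fun z => `|z| <= q%:R) s.
  apply/allP => z zs; apply: Aq.
  by rewrite eigenvalue_root_char sE root_prod_XsubC.
have ss : size s = d.
  have := congr1 (fun g : {poly C} => size g) sE.
  by rewrite size_char_poly size_prod_XsubC => -[].
have := coef_prod_XsubC_norm_le k (ler0n C q) sq.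
rewrite -sE ss -map_char_poly coef_map /= -intr_norm.
rewrite -(rmorph_nat (intr : int -> C)) -[1](rmorph1 (intr : int -> C)).
by rewrite -rmorphD -rmorphXn ler_int.
Qed.

(** [Om] is unimodular, so up to sign the determinant of the form is the product of the values of
    [g0] at eigenvalues of [A]. These are bounded in terms of [g0] and [q] alone, so [M] serves all
    [A], [Om] and [g1]. *)
Lemma polarization_reduction (d q : nat) (g0 : {poly int}) : exists M : int,
  forall (A V Om : 'M[int]_d.+1) (g1 : {poly int}),
    (0 < q)%N -> A *m V = q%:R *: 1%:M -> A *m Om = Om *m V^T ->
    Om \in unitmx -> (forall z : C, eigenvalue (Zc A) z -> `|z| <= q%:R) ->
    posdef (Zq (Om *m (horner_mx A g1)^T)) ->
    (forall z : C, eigenvalue (Zc A) z -> exists2 t : C, 0 < t &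
       (map_poly intr g0).[z] = t * (map_poly intr g1).[z]) ->
  posdef (Zq (Om *m (horner_mx A g0)^T)) /\
  exists2 U : 'M[int]_d.+1, U \in unitmx &
    forall i j, `|(U *m (Om *m (horner_mx A g0)^T) *m U^T) i j| <= M.
Proof.
pose b := \sum_(i < size g0) `|g0`_i| * q%:R ^+ i : int.
have [M HM] := reduced_bounded d.+1 (b ^+ d.+1)%:~R.
exists M => A V Om g1 q0 AV AOm Omu Aq G1p Hg.
have [G0p [z zA zdet]] := posdef_change_polarization q0 AV AOm G1p Hg.
split=> //; apply: HM => //.
rewrite det_map_mx ler_int; apply: le_trans (ler_norm _) _.
rewrite det_mulmx det_tr normrM.
have -> : `|\det Om| = 1.
  by move: Omu; rewrite unitmxE => /orP[] /eqP ->.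
rewrite mul1r -(ler_int C) intr_norm zdet normr_prod rmorphXn /=.
rewrite -[X in _ ^+ X]card_ord -prodr_const; apply: ler_prod => i _.
by rewrite normr_ge0; apply: horner_norm_le; apply: Aq.
Qed.

End EigenvalueBounds.

(** * Finiteness up to a relation *)

Section FinitelyMany.
Variables (T : Type) (iso : T -> T -> Prop).

(** The representatives [Y j] may lie outside [P]; this makes the notion pass to smaller
    predicates. *)
Definition finitely_many (P : T -> Prop) : Prop :=
  exists (J : finType) (Y : J -> T), forall x, P x -> exists j, iso x (Y j).

Lemma finitely_many_sub (P Q : T -> Prop) :
  (forall x, P x -> Q x) -> finitely_many Q -> finitely_many P.
Proof. by move=> PQ [J [Y HY]]; exists J, Y => x /PQ/HY. Qed.

Lemma finitely_many_iso (P : T -> Prop) :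
  (forall x y, P x -> P y -> iso x y) -> finitely_many P.
Proof.
move=> Piso; have [[x Px]|nP] := pselect (exists x, P x).
  by exists unit, (fun=> x) => y Py; exists tt; apply: Piso.
exists void, (of_void T) => x Px.
by case: nP; exists x.
Qed.

Lemma finitely_many_union (K : finType) (Q : K -> T -> Prop) :
  (forall k, finitely_many (Q k)) -> finitely_many (fun x => exists k, Q k x).
Proof.
move=> Qfin; pose J k := sval (cid (Qfin k)).
pose Y k : J k -> T := sval (cid (svalP (cid (Qfin k)))).
have HY k x : Q k x -> exists j, iso x (Y k j) := svalP (cid (svalP (cid (Qfin k)))) x.
exists {k : K & J k}, (fun u => Y _ (tagged u)).
by move=> x [k /HY[j xj]]; exists (Tagged J j).
Qed.

Lemma finitely_many_intmx (m n : nat) (M : int) (Q : 'M[int]_(m, n) -> T -> Prop) :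
    (forall B, finitely_many (Q B)) ->
  finitely_many (fun x =>
    exists2 B : 'M[int]_(m, n), (forall i j, `|B i j| <= M) & Q B x).
Proof.
(* The interval from [-|M|] to [|M|] has [2|M| + 1] integers; [dec] shifts ordinals down by
   [|M|]. *)
move=> Qfin; pose K := 'I_(`|M| + `|M|).+1.
pose dec (k : 'M[K]_(m, n)) : 'M[int]_(m, n) :=
  map_mx (fun i : K => (i : nat)%:Z - `|M|%N%:Z) k.
have := finitely_many_union (fun k => Qfin (dec k)); apply: finitely_many_sub.
move=> x [B BM QB]; exists (map_mx (fun z : int => inord (absz (z + `|M|%N%:Z))) B).
rewrite (_ : dec _ = B) //; apply/matrixP => i j; rewrite !mxE.
by have Bij := BM i j; rewrite inordK; lia.
Qed.

End FinitelyMany.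

(** * Deligne modules in coordinates *)

Section Frames.

Lemma additive_row_ext (d : nat) (U : zmodType) (f g : {additive 'rV[int]_d -> U}) :
  (forall i, f (delta_mx 0 i) = g (delta_mx 0 i)) -> f =1 g.
Proof.
move=> fg x; rewrite [x]row_sum_delta !raddf_sum; apply: eq_bigr => i _ /=.
by rewrite -[x 0 i]intz scaler_int !raddfMz fg.
Qed.

Variables (T : lmodType int) (d : nat) (e : {additive 'rV[int]_d -> T}).

Lemma frame_end (f : {additive T -> T}) : bijective e ->
  exists A : 'M[int]_d, forall x, f (e x) = e (x *m A).
Proof.
case=> g eK gK.
exists (\matrix_i g (f (e (delta_mx 0 i)))) => x.
set A := \matrix_i _.
apply: (additive_row_ext (f := f \o e) (g := e \o mulmxr A)) => i /=.
by rewrite -rowE rowK gK.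
Qed.

Lemma frame_form (omega : {biscalar T}) :
  exists Om : 'M[int]_d, forall x y, omega (e x) (e y) = (x *m Om *m y^T) 0 0.
Proof.
exists (\matrix_(i, j) omega (e (delta_mx 0 i)) (e (delta_mx 0 j))).
set Om := \matrix_(i, j) _ => x y.
have rB (u : 'rV[int]_d) : zmod_morphism (fun y : 'rV[int]_d => (u *m Om *m y^T) 0 0).
  by move=> a b; rewrite linearB mulmxBr !mxE.
have lB (u : 'rV[int]_d) : zmod_morphism (fun y : 'rV[int]_d => (y *m Om *m u^T) 0 0).
  by move=> a b; rewrite !mulmxBl !mxE.
pose gr u : {additive 'rV[int]_d -> int} :=
  HB.pack (fun y : 'rV[int]_d => (u *m Om *m y^T) 0 0)
  (GRing.isZmodMorphism.Build _ _ _ (rB u)).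
pose gl u : {additive 'rV[int]_d -> int} :=
  HB.pack (fun y : 'rV[int]_d => (y *m Om *m u^T) 0 0)
  (GRing.isZmodMorphism.Build _ _ _ (lB u)).
apply: (additive_row_ext (f := omega (e x) \o e) (g := gr x)) => j /=.
apply: (additive_row_ext (f := applyr omega (e (delta_mx 0 j)) \o e)
  (g := gl (delta_mx 0 j))) => i /=.
by rewrite form_delta mxE.
Qed.

End Frames.

(** * Polynomials in a matrix acting on eigenvectors *)

Section Evaluation.
Variable C : numFieldType.
Local Notation Zq := (map_mx (intr : int -> rat)).
Local Notation Zc := (map_mx (intr : int -> C)).
Local Notation Qc := (map_mx (ratr : rat -> C)).

(* [horner_mx] in a dimension that need not be a successor *)
Definition int_eval_mx (d : nat) (A : 'M[int]_d) (g : {poly int}) : 'M[int]_d :=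
  \sum_(i < size g) g`_i *: A ^+ i.

Lemma int_eval_mxE (d : nat) (A : 'M[int]_d.+1) (g : {poly int}) :
  int_eval_mx A g = horner_mx A g.
Proof.
have M0 : (0 : int)%:M = 0 :> 'M_d.+1 by apply/matrixP => i j; rewrite !mxE mul0rn.
have inj : injective (fun c : int => c%:M : 'M_d.+1).
  by move=> x y /matrixP/(_ 0 0); rewrite !mxE eqxx !mulr1n.
rewrite /horner_mx /horner_morph horner_coef size_map_inj_poly //.
apply: eq_bigr => i _; rewrite coef_map_id0 //.
by rewrite -mul_scalar_mx.
Qed.

Lemma map_mxX (d : nat) (K L : pzRingType) (f : {rmorphism K -> L})
    (A : 'M[K]_d) (i : nat) :
  map_mx f (A ^+ i) = map_mx f A ^+ i.
Proof.
elim: i => [|i IH]; first by rewrite !expr0; apply: map_mx1.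
by rewrite !exprS -IH; apply: map_mxM.
Qed.

Lemma map_int_eval_mx (d : nat) (A : 'M[int]_d) (g : {poly int}) :
  Zq (int_eval_mx A g) = eval_mx (Zq A) (map_poly intr g).
Proof.
rewrite /eval_mx size_map_inj_poly ?rmorph0 //; last exact: intr_inj.
rewrite [LHS](raddf_sum (map_mx _)); apply: eq_bigr => i _.
by rewrite /= map_mxZ map_mxX coef_map.
Qed.

Lemma eval_mx_eigen (d : nat) (A : 'M[rat]_d) (g : {poly rat}) (w : 'rV[C]_d) (z : C) :
  w *m Qc A = z *: w -> w *m Qc (eval_mx A g) = (map_poly ratr g).[z] *: w.
Proof.
move=> wA; have wX i : w *m Qc A ^+ i = z ^+ i *: w.
  elim: i => [|i IH]; first by rewrite !expr0 scale1r; apply: mulmx1.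
  rewrite !exprS; apply: etrans (mulmxA _ _ _) _.
  by rewrite wA -scalemxAl IH scalerA.
rewrite horner_coef size_map_poly scaler_suml [X in w *m X](raddf_sum (map_mx _)).
rewrite mulmx_sumr; apply: eq_bigr => i _.
by rewrite /= map_mxZ map_mxX -scalemxAr wX scalerA coef_map.
Qed.

(** Every element of [QA A] is a polynomial in [A], so it scales the eigenvector [w] by a factor
    that is unique as [w] is nonzero. In this way eigenvalues yield the embeddings over which the
    positivity condition ranges. *)
Lemma eigen_rmorphism (d : nat) (A : 'M[rat]_d) (w : 'rV[C]_d) (z : C) :
    w != 0 -> w *m Qc A = z *: w ->
  exists phi : {rmorphism QA A -> C}, forall M : QA A, w *m Qc M = phi M *: w.
Proof.
move=> w0 wA.
have ex (M : QA A) : exists s, w *m Qc M = s *: w.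
  have /asboolP[g ->] := QA_mxP M.
  by exists (map_poly ratr g).[z]; apply: eval_mx_eigen.
have [phi Hphi] := choice ex.
have inj (s t : C) : s *: w = t *: w -> s = t.
  by move/eqP; rewrite -subr_eq0 -scalerBl scaler_eq0 (negPf w0) orbF subr_eq0 => /eqP.
have phiB : zmod_morphism phi.
  move=> M N; apply: inj; rewrite -Hphi scalerBl -!Hphi -mulmxBr -map_mxB.
  by congr (_ *m map_mx _ _).
have phiM : monoid_morphism phi.
  split=> [|M N]; apply: inj; rewrite -Hphi.
    by rewrite scale1r (_ : QA_mx 1 = 1%:M) // map_mx1 mulmx1.
  rewrite (_ : QA_mx (M * N) = QA_mx M *m QA_mx N) // map_mxM mulmxA Hphi.
  by rewrite -scalemxAl Hphi scalerA.
pose phi' : {rmorphism QA A -> C} := HB.pack phi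
  (GRing.isZmodMorphism.Build _ _ phi phiB) (GRing.isMonoidMorphism.Build _ _ phi phiM).
by exists phi'.
Qed.

End Evaluation.

(** * Polarizations in coordinates *)

Section ModuleData.
Variables (R : realType) (p : nat) (Qpb : padic_closure R p) (n a : nat).
Variable v : R[i] -> \bar R.
Local Notation q := (p ^ a)%N.
Local Notation Zq := (map_mx (intr : int -> rat)).
Local Notation Zc := (map_mx (intr : int -> R[i])).
Local Notation Qc := (map_mx (ratr : rat -> R[i])).

(** The second clause expresses positivity at the conjugate embedding, which sends Frobenius to
    [q / z] and negates the value of [h]. *)
Definition iota_sign (h : {poly int}) (z : R[i]) : Prop :=
  ((0 < v z)%E -> positive_imaginary (map_poly intr h).[z]) /\
  ((0 < v (q%:R / z)%R)%E -> positive_imaginary (- (map_poly intr h).[z])).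

Lemma scaled_positive_imaginary (k : int) (x y : R[i]) :
  0 < k -> y = k%:~R * x -> positive_imaginary x -> positive_imaginary y.
Proof.
move=> k0 ->; case: x => xr xi [/= -> xi0].
have -> : k%:~R = (k%:~R : R)%:C by rewrite rmorph_int.
by split; rewrite /= !mul0r ?mulr0 ?subrr // addr0 mulr_gt0 // ltr0z.
Qed.

Lemma int_mxP (T : vectType int) (f : {linear T -> T}) (x : 'rV[int]_(dim T)) :
  f (r2v x) = r2v (x *m int_mx f).
Proof. by rewrite mul_rV_lin1 /= v2rK. Qed.

Lemma int_mx_mul (T : vectType int) (f g : {linear T -> T}) (m : nat) :
  (forall x, g (f x) = x *+ m) -> int_mx f *m int_mx g = m%:R *: 1%:M.
Proof.
move=> gf; apply/row_matrixP => i; rewrite !rowE -scalemxAr mulmx1.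
apply: (can_inj r2vK); rewrite mulmxA -!int_mxP gf scaler_nat.
by rewrite raddfMn.
Qed.

(** Replaces the rational element [iota] by an integral polynomial [h] in Frobenius, a positive
    multiple of it. The size [d] is kept apart from [dim D] so that it can be a successor. *)
Lemma polarization_data (D : deligne_module Qpb n a) (omega : {biscalar D})
    (d : nat) : (0 < q)%N -> dim D = d -> is_polarization v omega ->
  exists (e : {additive 'rV[int]_d -> D}) (A : 'M[int]_d) (h : {poly int}),
  [/\ bijective e, forall x, dmF D (e x) = e (x *m A),
      forall Om : 'M[int]_d,
        (forall x y, omega (e x) (e y) = (x *m Om *m y^T) 0 0) ->
        posdef (Zq (Om *m (int_eval_mx A h)^T)),
      forall z, eigenvalue (Zc A) z -> `|z| = sqrtC q%:R
    & forall z, eigenvalue (Zc A) z -> iota_sign h z].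
Proof.
move=> q0 E; case: d / E => -[_ _ omFV [c [iota [cF ciota iotaP Bs Bp]]]].
have /asboolP[g iotag] := QA_mxP iota.
have [h [k [k0 ghk]]] : exists (h : {poly int}) (k : int),
    0 < k /\ k%:~R *: g = map_poly intr h.
  have [h [b b0 ->]] := rat_poly_scale g.
  (* The sign of the denominator [b] is unknown; [b * b] is positive. *)
  exists (b *: h), (b * b); split; first by rewrite -expr2 exprn_even_gt0.
  by rewrite map_polyZ scalerA intrM mulfK // intr_eq0.
pose A := int_mx (dmF D).
have hA : Zq (int_eval_mx A h) = k%:~R *: QA_mx iota.
  by rewrite map_int_eval_mx -ghk iotag eval_mxZ.
exists r2v, A, h; split.
- by exists v2r; [exact: r2vK | exact: v2rK].
- by move=> x; rewrite int_mxP.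
- move=> Om OmE.
  have ZOm : Zq Om = gram_mx omega.
    by apply/matrixP => i j; rewrite !mxE OmE form_delta.
  have -> : Zq (Om *m (int_eval_mx A h)^T) = k%:~R *: (gram_mx omega *m (QA_mx iota)^T).
    by rewrite map_mxM ZOm -map_trmx hA linearZ /= -scalemxAr.
  have BE x y : rat_form omega x (y *m QA_mx iota) =
      (x *m (gram_mx omega *m (QA_mx iota)^T) *m y^T) 0 0.
    by rewrite /rat_form trmx_mul !mulmxA.
  split=> [|x x0].
    rewrite linearZ /=; congr (_ *: _); apply/matrixP => i j.
    by rewrite [LHS]mxE -form_delta -BE Bs BE form_delta.
  by rewrite -scalemxAr -scalemxAl mxE -BE mulr_gt0 ?ltr0z ?Bp.
- exact: dm_weil.
move=> z zeig; have /eigenvalueP[w wA w0] := zeig.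
have wA' : w *m Qc (rat_mx (dmF D)) = z *: w by rewrite map_ratr_int.
have [phi Hphi] := eigen_rmorphism w0 wA'.
have inj (s t : R[i]) : s *: w = t *: w -> s = t.
  by move/eqP; rewrite -subr_eq0 -scalerBl scaler_eq0 (negPf w0) orbF subr_eq0 => /eqP.
have phih : (map_poly intr h).[z] = k%:~R * phi iota.
  apply: inj; have := eval_mx_eigen (map_poly intr h) wA'.
  rewrite -map_poly_comp (eq_map_poly (fun c => ratr_int _ c)) => <-.
  by rewrite -map_int_eval_mx hA map_mxZ /= rmorph_int -scalemxAr Hphi scalerA.
have phiF : phi (QA_gen (rat_mx (dmF D))) = z by apply: inj; rewrite -Hphi.
split=> vz.
  by apply: scaled_positive_imaginary k0 phih _; apply: iotaP; rewrite /CM_type phiF.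
apply: (@scaled_positive_imaginary k (- phi iota) _ k0); first by rewrite phih mulrN.
(* Positivity is applied to [phi \o c]: it sends Frobenius to [q / z], because [V] scales [w] by
   that number. *)
rewrite -raddfN -ciota.
apply: (iotaP (phi \o c)).
rewrite /CM_type /= (_ : phi _ = q%:R / z) //.
have z0 : z != 0.
  by rewrite -normr_eq0 (dm_weil zeig) sqrtC_eq0 pnatr_eq0 -lt0n.
apply: (mulfI z0); rewrite mulrCA divff // mulr1.
apply: inj; rewrite -scalerA -Hphi cF scalemxAl -wA'.
rewrite -mulmxA -map_mxM /rat_mx -map_mxM map_ratr_int.
by rewrite (int_mx_mul (fun x => dm_VF x)) map_mxZ rmorph_nat map_mx1 -scalemxAr mulmx1.
Qed.

End ModuleData.

Lemma mulmx_row_ext (K : pzRingType) (m n : nat) (A B : 'M[K]_(m, n)) :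
  (forall x : 'rV_m, x *m A = x *m B) -> A = B.
Proof. by move=> AB; apply/row_matrixP => i; rewrite !rowE. Qed.

Lemma form_ext (K : pzRingType) (d : nat) (A B : 'M[K]_d) :
    (forall x y : 'rV_d, (x *m A *m y^T) 0 0 = (x *m B *m y^T) 0 0) -> A = B.
Proof. by move=> AB; apply/matrixP => i j; rewrite -(form_delta A) AB form_delta. Qed.

Lemma horner_mx_comm (K : comNzRingType) (d : nat) (A B U : 'M[K]_d.+1) (g : {poly K}) :
  U *m A = B *m U -> U *m horner_mx A g = horner_mx B g *m U.
Proof.
move=> UA; elim/poly_ind: g => [|g c IH]; first by rewrite !rmorph0 mulmx0 mul0mx.
rewrite !rmorphD !rmorphM /= !horner_mx_X !horner_mx_C mulmxDr mulmxDl.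
rewrite scalar_mxC; congr (_ + _).
by rewrite mulmxA IH -!mulmxA UA.
Qed.

Lemma horner_mx_tr (K : comNzRingType) (d : nat) (A : 'M[K]_d.+1) (g : {poly K}) :
  horner_mx A^T g = (horner_mx A g)^T.
Proof.
elim/poly_ind: g => [|g c IH]; first by rewrite !rmorph0 trmx0.
rewrite !rmorphD !rmorphM /= !horner_mx_X !horner_mx_C -!mulmxE IH.
rewrite -trmx_mul [RHS]linearD /= tr_scalar_mx; congr (_^T + _).
by have /comm_mx_horner := comm_mx_refl A; apply.
Qed.

Lemma positive_imaginary_ratio (R : realType) (x y : R[i]) :
  positive_imaginary x -> positive_imaginary y -> exists2 t : R[i], 0 < t & x = t * y.
Proof.
case: x y => [xr xi] [yr yi] [/= -> x0] [/= -> y0].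
exists (xi / yi)%:C; first by rewrite ltcR divr_gt0.
apply/eqP; rewrite eq_complex /= !mulr0 !mul0r subr0 addr0 eqxx /=.
by rewrite divfK // lt0r_neq0.
Qed.

(** The valuations of [z] and [q / z] add up to that of [q], which is [a > 0], so they are not both
    nonpositive. Additivity applies because both numbers are roots of integral characteristic
    polynomials, those of [A] and [V]. *)
Lemma eigen_valuation (R : realType) (p a : nat) (K : fieldType) (W : witt_ring p K)
    (eps : {rmorphism W -> R[i]}) (v : R[i] -> \bar R) (d : nat) (A V : 'M[int]_d)
    (z : R[i]) :
    valuation_of_embedding eps v -> (0 < a)%N -> z != 0 ->
    A *m V = (p ^ a)%N%:R *: 1%:M -> eigenvalue (map_mx intr A) z ->
  (0 < v z)%E \/ (0 < v ((p ^ a)%N%:R / z)%R)%E.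
Proof.
move=> [[_ _ vM _] vp] a0 z0 AV zA.
have alg (B : 'M[int]_d) (y : R[i]) : eigenvalue (map_mx intr B) y ->
    exists2 g : {poly W}, map_poly eps g != 0 & root (map_poly eps g) y.
  move=> yB; exists (map_poly intr (char_poly B)).
    rewrite -map_poly_comp (eq_map_poly (fun c => rmorph_int eps c)).
    by rewrite map_char_poly monic_neq0 ?char_poly_monic.
  rewrite -map_poly_comp (eq_map_poly (fun c => rmorph_int eps c)).
  by rewrite map_char_poly -eigenvalue_root_char.
have qzV : eigenvalue (map_mx intr V) ((p ^ a)%N%:R / z).
  have /eigenvalueP[w wA w0] := zA; apply/eigenvalueP; exists w => //.
  apply: (scalerI z0); rewrite scalerA mulrCA divff // mulr1.
  rewrite scalemxAl -wA -mulmxA -map_mxM AV map_mxZ rmorph_nat map_mx1.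
  by rewrite -scalemxAr mulmx1.
have := vM _ _ (alg _ _ zA) (alg _ _ qzV).
have := vp 1 a (unitr1 _); rewrite mul1r rmorphXn rmorph_nat /= -natrX => vq.
rewrite mulrCA divff // mulr1 vq => E.
apply/orP; apply/negPn/negP.
rewrite negb_or -!leNgt => /andP[h1 h2].
have := adde_le0 h1 h2; rewrite -E lee_fin lern0 => /eqP a00.
by rewrite a00 in a0.
Qed.

(** * Matrix models and their isomorphisms *)

Section Models.
Variables (R : realType) (p : nat) (Qpb : padic_closure R p) (n a N : nat).
Variable v : R[i] -> \bar R.
Local Notation q := (p ^ a)%N.
Local Notation Zq := (map_mx (intr : int -> rat)).
Local Notation Zc := (map_mx (intr : int -> R[i])).
Implicit Types X Y : real_level_module Qpb n a v N.

Record model d X (e : {additive 'rV[int]_d -> X})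
    (A V Tau Om : 'M[int]_d) : Prop := Model {
  model_bij : bijective e;
  model_F : forall x, dmF X (e x) = e (x *m A);
  model_V : forall x, dmV X (e x) = e (x *m V);
  model_tau : forall x, rl_tau X (e x) = e (x *m Tau);
  model_omega : forall x y, rl_omega X (e x) (e y) = (x *m Om *m y^T) 0 0 }.

Lemma frame_model d X (e : {additive 'rV[int]_d -> X}) : bijective e ->
  exists A V Tau Om, model e A V Tau Om.
Proof.
move=> eb; have [A HA] := frame_end (dmF X) eb; have [V HV] := frame_end (dmV X) eb.
have [Tau HT] := frame_end (rl_tau X) eb; have [Om HOm] := frame_form e (rl_omega X).
by exists A, V, Tau, Om.
Qed.

Lemma model_change d X (e : {additive 'rV[int]_d -> X}) (A V Tau Om U : 'M[int]_d) :
    model e A V Tau Om -> U \in unitmx ->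
  exists e' : {additive 'rV[int]_d -> X},
    model e' (U *m A *m invmx U) (U *m V *m invmx U) (U *m Tau *m invmx U)
      (U *m Om *m U^T).
Proof.
move=> [[g eK gK] HA HV HT HOm] Uu; exists (e \o mulmxr U); split=> /=.
- exists (mulmxr (invmx U) \o g) => x /=; first by rewrite eK mulmxK.
  by rewrite mulmxKV.
- by move=> x; rewrite HA !mulmxA mulmxKV.
- by move=> x; rewrite HV !mulmxA mulmxKV.
- by move=> x; rewrite HT !mulmxA mulmxKV.
- by move=> x y; rewrite HOm trmx_mul !mulmxA.
Qed.

Section Relations.
Variables (d : nat) (X : real_level_module Qpb n a v N).
Variables (e : {additive 'rV[int]_d -> X}) (A V Tau Om : 'M[int]_d).
Hypothesis m : model e A V Tau Om.

Let e_inj : injective e := bij_inj (model_bij m).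

Lemma model_FV : A *m V = q%:R *: 1%:M.
Proof.
apply: mulmx_row_ext => x; apply: e_inj.
rewrite mulmxA -(model_V m) -(model_F m) dm_VF -scalemxAr mulmx1 scaler_nat.
by rewrite raddfMn.
Qed.

Lemma model_FOm : A *m Om = Om *m V^T.
Proof.
apply: form_ext => x y; rewrite mulmxA -(model_omega m) -(model_F m).
have [_ _ -> _] := rl_polarization X.
by rewrite (model_V m) (model_omega m) trmx_mul !mulmxA.
Qed.

Lemma model_Om_alt : Om^T = - Om.
Proof.
have alt x : rl_omega X x x = 0 by have [-> _ _ _] := rl_polarization X.
apply/matrixP => i j; rewrite !mxE.
have := alt (e (delta_mx 0 i) + e (delta_mx 0 j)).
rewrite linearDl linearDr linearDr !alt add0r addr0 !(model_omega m) !form_delta.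
by move/eqP; rewrite addrC addr_eq0 => /eqP.
Qed.

Lemma model_tau_invol : Tau *m Tau = 1%:M.
Proof.
apply: mulmx_row_ext => x; apply: e_inj.
by rewrite mulmxA -!(model_tau m) mulmx1; have [-> _ _] := rl_real X.
Qed.

Lemma model_tauF : Tau *m A = V *m Tau.
Proof.
suff TAT : Tau *m A *m Tau = V.
  by rewrite -TAT -mulmxA model_tau_invol mulmx1.
apply: mulmx_row_ext => x; apply: e_inj.
rewrite !mulmxA -!(model_tau m) -(model_F m) -(model_tau m) -(model_V m).
by have [_ -> _] := rl_real X.
Qed.

Lemma model_tauOm : Tau *m Om *m Tau^T = - Om.
Proof.
apply: form_ext => x y.
rewrite mulmxN mulNmx [RHS]mxE -(model_omega m).
have [_ _ <-] := rl_real X.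
by rewrite !(model_tau m) (model_omega m) trmx_mul !mulmxA.
Qed.

(** Principality represents each coordinate functional by a vector, and these vectors are the rows
    of a left inverse of [Om]. *)
Lemma model_Om_unit : Om \in unitmx.
Proof.
have [g eK gK] := model_bij m.
have coord (j : 'I_d) : exists u : 'rV[int]_d,
    forall y : 'rV_d, (u *m Om *m y^T) 0 0 = y 0 j.
  have lin : linear_for *%R (fun t : X => g t 0 j).
    move=> c s t; rewrite -[s]gK -[t]gK -[c]intz scaler_int -raddfMz -raddfD !eK.
    by rewrite !mxE -scaler_int mxE.
  pose f : {scalar X} :=
    HB.pack (fun t : X => g t 0 j) (GRing.isLinear.Build _ _ _ _ _ lin).
  have [s [Hs _]] := rl_principal f.
  by exists (g s) => y; rewrite -(model_omega m) gK Hs /= eK.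
have [M HM] := choice coord.
have : (\matrix_j M j) *m Om = 1%:M.
  apply/matrixP => i j.
  by rewrite -(form_delta (_ *m Om)) mulmxA -rowE rowK HM !mxE eqxx eq_sym.
by case/mulmx1_unit.
Qed.

End Relations.

(** Exchanging [A] with [V] and negating [Om], the involution takes [G] to
    [- Om *m h(V)^T = - h(A) *m Om]. As [Om] is alternating this is [G^T], which equals [G]. *)
Lemma model_tau_isometry d X (e : {additive 'rV[int]_d.+1 -> X})
    (A V Tau Om : 'M[int]_d.+1) (h : {poly int}) :
  let G := Om *m (horner_mx A h)^T in
  model e A V Tau Om -> G^T = G -> Tau *m G *m Tau^T = G.
Proof.
move=> G m Gs; rewrite /G mulmxA -mulmxA -trmx_mul.
rewrite (horner_mx_comm h (model_tauF m)) trmx_mul mulmxA (model_tauOm m).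
rewrite -horner_mx_tr mulNmx (horner_mx_comm h (esym (model_FOm m))) -mulmxN.
by rewrite -(model_Om_alt m) -[RHS]/G -Gs /G trmx_mul trmxK.
Qed.

Lemma posdef_horner_unit d (A Om : 'M[int]_d.+1) (h : {poly int}) :
  posdef (Zq (Om *m (horner_mx A h)^T)) -> Zq (horner_mx A h)^T \in unitmx.
Proof. by move=> /posdef_unit; rewrite map_mxM unitmx_mul => /andP[]. Qed.

(** The data that determine the isomorphism class; [b] records the level structure on a basis. *)
Definition coded d (h : {poly int}) (G A Tau : 'M[int]_d.+1)
    (b : {ffun 'I_d.+1 -> 'rV[ZmodN N]_(n + n)}) X : Prop :=
  exists (e : {additive 'rV[int]_d.+1 -> X}) V Om,
    [/\ model e A V Tau Om, Om *m (horner_mx A h)^T = G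
      & forall i, rl_beta X (e (delta_mx 0 i)) = b i].

(** Definiteness of [G] makes [horner_mx A h] invertible over the rationals, so [G] and [A]
    determine [Om]. The isomorphism then matches the two bases [e] and [e']. *)
Lemma coded_iso d (h : {poly int}) (G A Tau : 'M[int]_d.+1)
    (b : {ffun 'I_d.+1 -> 'rV[ZmodN N]_(n + n)}) X Y :
  posdef (Zq G) -> coded h G A Tau b X -> coded h G A Tau b Y -> rl_iso X Y.
Proof.
move=> Gp [e [V [Om [m mG mb]]]] [e' [V' [Om' [m' mG' mb']]]].
have OmE : Om = Om'.
  have Hu : Zq (horner_mx A h)^T \in unitmx.
    by apply: (@posdef_horner_unit _ _ Om); rewrite mG.
  have : Zq Om = Zq Om'.
    by apply: (can_inj (mulmxK Hu)); rewrite -!map_mxM mG mG'.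
  move/matrixP => E; apply/matrixP => i j.
  by have /eqP := E i j; rewrite !mxE eqr_int => /eqP.
rewrite -{}OmE in m' mG'.
have [g eK gK] := model_bij m.
have gB : zmod_morphism (e' \o g).
  move=> x y /=; rewrite -raddfB; congr (e' _).
  by rewrite -{1}[x]gK -{1}[y]gK -raddfB eK.
pose f : {additive X -> Y} := HB.pack (e' \o g) (GRing.isZmodMorphism.Build _ _ _ gB).
have fe x : f (e x) = e' x by rewrite /= eK.
exists f; split.
- by apply: bij_comp; [exact: model_bij m' | exists e].
- by move=> x; rewrite -[x]gK (model_F m) !fe (model_F m').
- by move=> x; rewrite -[x]gK (model_tau m) !fe (model_tau m').
- by move=> x y; rewrite -[x]gK -[y]gK !fe (model_omega m) (model_omega m').
- move=> x; rewrite -[x]gK fe; move: (g x) => {}x.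
  apply: (additive_row_ext (f := rl_beta Y \o e') (g := rl_beta X \o e)) => i /=.
  by rewrite mb mb'.
Qed.

End Models.

(** * Finiteness *)

Section Finiteness.
Variables (R : realType) (p : nat) (Qpb : padic_closure R p) (n a N : nat).
Variable v : R[i] -> \bar R.
Local Notation q := (p ^ a)%N.
Local Notation Zq := (map_mx (intr : int -> rat)).
Local Notation Zc := (map_mx (intr : int -> R[i])).
Local Notation module := (real_level_module Qpb n a v N).
Local Notation finite := (finitely_many (@rl_iso R p Qpb n a v N)).

Definition with_gram d (h : {poly int}) (G : 'M[int]_d.+1) (X : module) : Prop :=
  posdef (Zq G) /\ exists (e : {additive 'rV[int]_d.+1 -> X}) A V Tau Om,
    model e A V Tau Om /\ Om *m (horner_mx A h)^T = G.

(** A bounded [A], a bounded [Tau] and one of finitely many functions from the basis to a finite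
    group give finitely many codes, each with at most one isomorphism class. *)
Lemma with_gram_finite d h (G : 'M[int]_d.+1) : finite (with_gram h G).
Proof.
have [Gp|nG] := pselect (posdef (Zq G)); last first.
  by apply: finitely_many_iso => X Y [].
have [MA HA] := similitudes_bounded (q%:R : int) Gp.
have [MT HT] := similitudes_bounded (1 : int) Gp.
pose b_type := {ffun 'I_d.+1 -> 'rV[ZmodN N]_(n + n)}.
have := @finitely_many_intmx _ (@rl_iso R p Qpb n a v N) _ _ MA _
  (fun A : 'M[int]_d.+1 =>
  @finitely_many_intmx _ _ _ _ MT _ (fun Tau : 'M[int]_d.+1 =>
  @finitely_many_union _ _ b_type _ (fun b =>
  @finitely_many_iso _ _ _ (fun X Y =>
    @coded_iso R p Qpb n a N v d h G A Tau b X Y Gp)))).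
apply: finitely_many_sub => X [_ [e [A [V [Tau [Om [m mG]]]]]]].
exists A.
  by apply: HA; rewrite -mG; apply: form_horner_similitude (model_FV m) (model_FOm m).
exists Tau.
  apply: HT; rewrite scale1r -mG; apply: (model_tau_isometry m); rewrite mG.
  have [/matrixP Gs _] := Gp; apply/matrixP => i j.
  by have /eqP := Gs i j; rewrite !mxE eqr_int => /eqP.
exists [ffun i => rl_beta X (e (delta_mx 0 i))], e, V, Om; split=> // i.
by rewrite ffunE.
Qed.

Definition polarized_by d (A V Om : 'M[int]_d.+1) (h : {poly int}) : Prop :=
  [/\ posdef (Zq (Om *m (horner_mx A h)^T)),
      forall z : R[i], eigenvalue (Zc A) z -> `|z| <= q%:R
    & forall z, eigenvalue (Zc A) z ->
        ((0 < v z)%E \/ (0 < v (q%:R / z)%R)%E) /\ iota_sign p a v h z].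

(** A polynomial of degree [d.+1] has [d.+2] coefficients; stored as an integer matrix it falls
    under [finitely_many_intmx]. *)
Definition with_char_poly d (c : 'rV[int]_d.+2) (X : module) : Prop :=
  exists (e : {additive 'rV[int]_d.+1 -> X}) A V Tau Om h,
    [/\ model e A V Tau Om, polarized_by A V Om h & poly_rV (char_poly A) = c].

Lemma with_char_poly_finite d (c : 'rV[int]_d.+2) :
  (0 < q)%N -> finite (with_char_poly c).
Proof.
move=> q0; have [[X0 cX0]|nX] := pselect (exists X, with_char_poly c X); last first.
  by apply: finitely_many_iso => X Y cX; case: nX; exists X.
(* [h0] comes from one reference module, so [M] is fixed before [X] is considered. *)
have [e0 [A0 [V0 [Tau0 [Om0 [h0 [m0 [_ _ s0] c0]]]]]]] := cX0.
have [M HM] := @polarization_reduction R[i] d q h0.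
have := @finitely_many_intmx _ (@rl_iso R p Qpb n a v N) _ _ M _
  (fun G : 'M[int]_d.+1 =>
  @with_gram_finite d h0 G).
apply: finitely_many_sub => X [e [A [V [Tau [Om [h [m [G1p Aq sA] cA]]]]]]].
have AA0 : char_poly A = char_poly A0.
  have /(congr1 rVpoly) : poly_rV (char_poly A) = poly_rV (char_poly A0) :> 'rV_d.+2.
    by rewrite cA c0.
  by rewrite !poly_rV_K ?size_char_poly.
have ratio z : eigenvalue (Zc A) z -> exists2 t : R[i], 0 < t &
    (map_poly intr h0).[z] = t * (map_poly intr h).[z].
  move=> zA; have zA0 : eigenvalue (Zc A0) z.
    by move: zA; rewrite !eigenvalue_root_char -!map_char_poly AA0.
  have [vz [h1 h2]] := sA _ zA; have [_ [k1 k2]] := s0 _ zA0.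
  (* If [z] has positive valuation, both values are positive imaginary; if [q / z] has, both
     negatives are. Either way the ratio is positive. *)
  case: vz => vz; first exact: positive_imaginary_ratio (k1 vz) (h1 vz).
  have [t t0 E] := positive_imaginary_ratio (k2 vz) (h2 vz).
  by exists t => //; apply: oppr_inj; rewrite E mulrN.
have [G0p [U Uu UM]] :=
  HM _ _ _ _ q0 (model_FV m) (model_FOm m) (model_Om_unit m) Aq G1p ratio.
have [e' m'] := model_change m Uu.
exists (U *m (Om *m (horner_mx A h0)^T) *m U^T) => //.
split.
  rewrite !map_mxM /= -!map_trmx; apply: posdef_congr; first exact: map_mx_unit.
  by rewrite map_trmx -map_mxM.
exists e'; do 4!eexists; split; first exact: m'.
(* Evaluating [h0] commutes with conjugation by [U], so the change of basis acts on the Gram matrix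
   by congruence. *)
have : U *m A = U *m A *m invmx U *m U by rewrite mulmxKV.
move=> /(horner_mx_comm h0) UH.
have -> : (horner_mx (U *m A *m invmx U) h0)^T =
    (invmx U)^T *m (horner_mx A h0)^T *m U^T.
  by rewrite -!trmx_mul mulmxA UH mulmxK.
by rewrite !mulmxA -(mulmxA _ U^T) -trmx_mul mulVmx // trmx1 mulmx1.
Qed.

End Finiteness.

Theorem theorem3p9 (R : realType) (p a n N : nat)
    (p_prime : prime p) (a_gt0 : (0 < a)%N) (n_gt0 : (0 < n)%N)
    (N_gt0 : (0 < N)%N) (p_ndvd_N : ~~ (p %| N)%N)
    (k : finFieldType) (card_k : #|k| = (p ^ a)%N)
    (kbar : closedFieldType) (k_inj : {rmorphism k -> kbar})
    (kbar_alg : integralRange k_inj)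
    (W : witt_ring p kbar) (eps : {rmorphism W -> R[i]})
    (eps_inj : injective eps)
    (val_p : R[i] -> \bar R) (val_pP : valuation_of_embedding eps val_p)
    (Qpb : padic_closure R p) :
  exists (m : nat) (Y : 'I_m -> real_level_module Qpb n a val_p N),
  forall X : real_level_module Qpb n a val_p N,
  exists i : 'I_m, rl_iso X (Y i).
Proof.
have q0 : (0 < p ^ a)%N by rewrite expn_gt0 prime_gt0.
(* The rank is positive, so it can be written as the successor that [horner_mx] requires. *)
pose d := (2 * n).-1; have dE : (2 * n)%N = d.+1 by rewrite prednK // muln_gt0.
suff [J [Y HY]] : finitely_many (@rl_iso R p Qpb n a val_p N) (fun=> True).
  exists #|J|, (fun i => Y (enum_val i)) => X; have [j Xj] := HY X I.
  by exists (enum_rank j); rewrite enum_rankK.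
have := @finitely_many_intmx _ (@rl_iso R p Qpb n a val_p N) _ _
  ((1 + (p ^ a)%N%:R) ^+ d.+1) _
  (fun c : 'rV[int]_d.+2 => @with_char_poly_finite R p Qpb n a N val_p d c q0).
apply: finitely_many_sub => X _.
have dimX : dim X = d.+1 by rewrite dm_rank.
have [e [A [h [eb eA hG Aq hs]]]] := polarization_data q0 dimX (rl_polarization X).
have [A' [V [Tau [Om m]]]] := frame_model eb.
have AA : A' = A.
  by apply: mulmx_row_ext => x; apply: (bij_inj eb); rewrite -eA (model_F m).
rewrite {A'}AA in m.
(* Weakening the bound from [sqrtC q] to [q] keeps the coefficient bound an integer. *)
have Aqq z : eigenvalue (map_mx intr A) z -> `|z| <= (p ^ a)%N%:R :> R[i].
  move=> /Aq ->; rewrite -(ler_pXn2r (n := 2)) ?nnegrE ?sqrtC_ge0 //.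
  by rewrite sqrtCK expr2 -natrM ler_nat leq_pmulr.
exists (poly_rV (char_poly A)).
  by move=> i j; rewrite mxE; apply: char_poly_coef_bounded Aqq.
exists e, A, V, Tau, Om, h; split=> //; split=> //.
  by rewrite -int_eval_mxE; apply: hG; apply: model_omega m.
move=> z zA; split; last exact: hs.
have z0 : z != 0 by rewrite -normr_eq0 (Aq _ zA) sqrtC_eq0 pnatr_eq0 -lt0n.
exact: eigen_valuation val_pP a_gt0 z0 (model_FV m) zA.
Qed.
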